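(* Let $R$ be a commutative Noetherian ring, $N$ a non-zero finitely generated $R$-module and $\mathfrak a$ an ideal of $R$. Let $0=N_1\cap\dots\cap N_n$ be a minimal primary decomposition of the zero submodule of $N$ with $\operatorname{Ass}_R(N/N_i)=\{\mathfrak p_i\}$ for all $1\le i\le n$. For each $t\in\mathbb Z$ set $\Delta(t):=\{\mathfrak p\in\operatorname{Ass}_R(N):\operatorname{cd}_R(\mathfrak a,R/\mathfrak p)\ge t\}$. Then the following statements hold. (i) $$\bigcap_{\mathfrak p_i\in\Delta(t)}N_i=\bigcap_{\mathfrak p\in\Delta(t)}C^N_{\mathfrak p}(0)=C^N_{S(t)}(0)=\Gamma_{\mathfrak a(t)}(N),$$ where $S(t):=R\setminus\bigcup_{\mathfrak p\in\Delta(t)}\mathfrak p$ and $\mathfrak a(t):=\bigcap_{\mathfrak p\in\operatorname{Ass}_R(N),\ \operatorname{cd}_R(\mathfrak a,R/\mathfrak p)<t}\mathfrak p$. In particular, $\bigcap_{\mathfrak p_i\in\Delta(t)}N_i$ is independent of the choice of minimal primary decomposition of the zero submodule of $N$. (ii) For each submodule $L$ of $N$, $\operatorname{cd}_R(\mathfrak a,L)<t$ if and only if $L\subseteq C^N_{S(t)}(0)$. (iii) $$\operatorname{Ann}_R\Big(N/\bigcap_{\mathfrak p\in\Delta(t)}C^N_{\mathfrak p}(0)\Big)=\bigcap_{\mathfrak p\in\Delta(t)}C_{\mathfrak p}(\operatorname{Ann}_R(N))\subseteq\operatorname{Ann}_R(H^t_{\mathfrak a}(N)).$$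
   Context: $R$ is a commutative Noetherian ring with non-zero identity. $H^i_{\mathfrak a}(N)=\varinjlim_n\operatorname{Ext}^i_R(R/\mathfrak a^n,N)$ is the $i$-th local cohomology module (zero for $i<0$), and $\Gamma_{\mathfrak b}(N)=\bigcup_{t\in\mathbb N}(0:_N\mathfrak b^t)$. The cohomological dimension is $\operatorname{cd}_R(\mathfrak a,N):=\sup\{i\ge 0: H^i_{\mathfrak a}(N)\neq 0\}$, with $\sup\emptyset=-\infty$. For a multiplicatively closed subset $S$ of $R$ and a submodule $L$ of $N$, $C^N_S(L)$ denotes the preimage of $S^{-1}L$ under the canonical map $N\to S^{-1}N$; for $\mathfrak p\in\operatorname{Supp}_R(N)$, $C^N_{\mathfrak p}(L):=C^N_{R\setminus\mathfrak p}(L)$; for an ideal $\mathfrak b$, $C_{\mathfrak p}(\mathfrak b):=C^R_{\mathfrak p}(\mathfrak b)$. A minimal primary decomposition is an irredundant one with distinct associated primes. Conventions: the intersection of an empty family of subsets of a set $A$ is $A$ (so an empty intersection of submodules of $N$ is $N$ and an empty intersection of ideals is $R$); the union of an empty family is empty. Hence if $\Delta(t)=\emptyset$ then $S(t)=R$ and $C^N_{S(t)}(0)=N$. *)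

(* Defs.v *)
From HB Require Import structures.
From mathcomp Require Import all_boot all_order all_algebra generic_quotient.
From mathcomp Require Import ring.
From mathcomp Require Import boolp classical_sets functions constructive_ereal.
From mathcomp.multinomials Require Import freeg.

Set Implicit Arguments.
Unset Strict Implicit.
Unset Printing Implicit Defensive.

Import GRing.Theory.
Local Open Scope ring_scope.
Local Open Scope classical_set_scope.
Local Open Scope quotient_scope.

(* Submodules of M are bundled as [submodClosed M]; ideals of R are the
   submodules of the regular module R^o ([idealr R] would exclude R itself). *)

Section SubmodulesAndQuotients.
Variables (R : comNzRingType) (M : lmodType R) (L : submodClosed M).

Definition submodule := {x : M | x \in L}.
HB.instance Definition _ := SubChoice.on submodule.
Fact submodule_closed : subsemimod_closed (fun x : M => x \in L).
Proof. exact: (GRing.subsemimodClosedP L). Qed.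
HB.instance Definition _ :=
  GRing.SubChoice_isSubLmodule.Build _ _ _ submodule submodule_closed.

(* On an lmodType, [submodClosed] has no library coercion to [zmodClosed]. *)
Definition submod_zmod : zmodClosed M :=
  HB.pack (GRing.SubmodClosed.sort L) (GRing.isZmodClosed.Build M _
    (GRing.subsemimod_closedB (GRing.subsemimodClosedP L))).

Definition quotmod := Quotient.quot submod_zmod.
HB.instance Definition _ := GRing.Zmodule.on quotmod.
HB.instance Definition _ := Quotient.on quotmod.

Lemma eq_quotmod (x y : M) : (x == y %[mod quotmod]) = (x - y \in L).
Proof. by rewrite -Quotient.idealrBE. Qed.

Definition qscale (r : R) := lift_op1 quotmod ( *:%R r).

Lemma pi_qscale r : {morph \pi_quotmod : x / r *: x >-> qscale r x}.
Proof.
move=> x; unlock qscale; apply/eqP; rewrite eq_quotmod -scalerBr.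
by rewrite rpredZ // -eq_quotmod reprK.
Qed.

Lemma qscaleA r s x : qscale r (qscale s x) = qscale (r * s) x.
Proof. by rewrite -[x]reprK -!pi_qscale scalerA. Qed.
Lemma qscale1 : left_id 1 qscale.
Proof. by move=> x; rewrite -[x]reprK -!pi_qscale scale1r. Qed.
Lemma pi_quotD : {morph \pi_quotmod : x y / x + y}.
Proof. exact: (@Quotient.pi_add _ submod_zmod). Qed.
Lemma qscaleDr : right_distributive qscale +%R.
Proof.
move=> r x y; rewrite -[x]reprK -[y]reprK -!pi_qscale.
by rewrite -!pi_quotD -pi_qscale scalerDr.
Qed.
Lemma qscaleDl x : {morph qscale^~ x : r s / r + s}.
Proof. by move=> r s; rewrite -[x]reprK -!pi_qscale scalerDl pi_quotD. Qed.

HB.instance Definition _ := GRing.Zmodule_isLmodule.Build R quotmod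
  qscaleA qscale1 qscaleDr qscaleDl.

Lemma pi_quot_linear r x y :
  \pi_quotmod (r *: x + y) = r *: \pi_quotmod x + \pi_quotmod y.
Proof. by rewrite pi_quotD pi_qscale. Qed.

Lemma pi_quot0 : \pi_quotmod 0 = 0.
Proof.
have := pi_quot_linear (-1) 0 0.
by rewrite scaler0 addr0 => ->; rewrite scaleN1r addNr.
Qed.

End SubmodulesAndQuotients.

Section SubmoduleOfSet.
Variables (R : comNzRingType) (M : lmodType R).

Definition submod_set (A : set M) : Prop :=
  A 0 /\ forall r x y, A x -> A y -> A (r *: x + y).

Lemma submod_set_closed (A : set M) :
  submod_set A -> subsemimod_closed (mem A : {pred M}).
Proof.
move=> [A0 AD]; split.
  split; first by rewrite inE.
  by move=> x y; rewrite !inE -{2}[x]scale1r; exact: AD.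
by move=> r x; rewrite !inE -[r *: x]addr0 => Ax; apply: AD.
Qed.

Definition submod_of (A : set M) (sA : submod_set A) : submodClosed M :=
  HB.pack (mem A : {pred M})
    (GRing.isSubmodClosed.Build R M (mem A : {pred M}) (submod_set_closed sA)).

Lemma submod_ofE (A : set M) (sA : submod_set A) : [set` submod_of sA] = A.
Proof. by apply/seteqP; split=> x /=; [exact: set_mem | exact: mem_set]. Qed.

Lemma in_submod_of (A : set M) (sA : submod_set A) x :
  (x \in submod_of sA) = (x \in A).
Proof. by []. Qed.

Lemma submodP (L : submodClosed M) : submod_set [set` L].
Proof.
have [[L0 LD] LZ] := GRing.subsemimodClosedP L.
by split=> // r x y /= Lx Ly; apply: LD => //; apply: LZ.
Qed.

Lemma submod_inj (L L' : submodClosed M) : [set` L] = [set` L'] -> L = L'.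
Proof.
case: L => L [[h1] [h2]]; case: L' => L' [[h1'] [h2']] /= /seteqP[LL' L'L].
have e : L = L' by apply/funext => x; apply/idP/idP => [/LL'|/L'L].
subst L'; rewrite (Prop_irrelevance h1 h1').
by rewrite (Prop_irrelevance h2 h2').
Qed.

End SubmoduleOfSet.

Section Kernels.
Variables (R : comNzRingType) (M N : lmodType R) (f : {linear M -> N}).

Fact ker_subproof : submod_set [set x | f x = 0].
Proof.
by split=> [|r x y /= fx fy]; rewrite /= ?linear0 // linearP fx fy scaler0 addr0.
Qed.
Definition lin_ker : submodClosed M := submod_of ker_subproof.

Fact im_subproof : submod_set (range f).
Proof.
split=> [|r _ _ [x _ <-] [y _ <-]]; first by exists 0; rewrite ?linear0.
by exists (r *: x + y); rewrite ?linearP.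
Qed.
Definition lin_im : submodClosed N := submod_of im_subproof.

End Kernels.

Section SubmoduleMap.
Variables (R : comNzRingType) (M N : lmodType R) (f : {linear M -> N}).
Variables (A : submodClosed M) (B : submodClosed N).
Hypothesis fAB : forall x, x \in A -> f x \in B.

Definition submod_map (x : submodule A) : submodule B :=
  Sub (f (val x)) (fAB (valP x)).
Fact submod_map_linear : linear submod_map.
Proof. by move=> r x y; apply: val_inj; rewrite /= linearP. Qed.
HB.instance Definition _ :=
  GRing.isLinear.Build R (submodule A) (submodule B) _ submod_map
    submod_map_linear.

End SubmoduleMap.

Section QuotientMap.
Variables (R : comNzRingType) (M N : lmodType R) (f : {linear M -> N}).
Variables (A : submodClosed M) (B : submodClosed N).
Definition quot_map of (forall x, x \in A -> f x \in B) :=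
  fun x : quotmod A => \pi_(quotmod B) (f (repr x)).

Hypothesis fAB : forall x, x \in A -> f x \in B.

Fact quot_map_pi x :
  quot_map fAB (\pi_(quotmod A) x) = \pi_(quotmod B) (f x).
Proof.
apply/eqP; rewrite eq_quotmod -linearB; apply: fAB.
by rewrite -eq_quotmod reprK.
Qed.
Fact quot_map_linear : linear (quot_map fAB).
Proof.
move=> r x y; rewrite -[x]reprK -[y]reprK !quot_map_pi.
by rewrite -pi_quot_linear quot_map_pi linearP pi_quot_linear.
Qed.
HB.instance Definition _ :=
  GRing.isLinear.Build R (quotmod A) (quotmod B) _ (quot_map fAB)
    quot_map_linear.

End QuotientMap.

Section FreeModules.
Variable R : comNzRingType.

Section Lift.
Variables (T : choiceType) (M : lmodType R) (f : T -> M).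
HB.instance Definition _ :=
  GRing.isZmodMorphism.Build {freeg T / R} M (fglift f) (lift_is_additive f).
Fact fglift_scalable : scalable (fglift f).
Proof.
move=> c D; rewrite -{2}[D]freeg_sumE [c *: D]/(fgscale c D) /fgscale.
rewrite 2!raddf_sum /=.
by rewrite scaler_sumr; apply: eq_bigr => x _; rewrite !liftU scalerA.
Qed.
HB.instance Definition _ :=
  GRing.isScalable.Build R {freeg T / R} M *:%R (fglift f) fglift_scalable.
End Lift.

Lemma freeg_ext (T : choiceType) (M : lmodType R)
    (f g : {linear {freeg T / R} -> M}) :
  (forall x, f << x >> = g << x >>) -> f =1 g.
Proof.
move=> fg D; rewrite -[D]freeg_sumE !linear_sum; apply: eq_bigr => x _.
have -> : << coeff x D *g x >> = coeff x D *: << x >> :> {freeg T / R}.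
  by apply/eqP/freeg_eqP => y; rewrite coeffZ !coeffU mul1r.
by rewrite [LHS]linearZ [RHS]linearZ /= fg.
Qed.

Definition free_mod (M : lmodType R) : lmodType R := {freeg M / R}.

Definition free_eval (M : lmodType R) : {linear free_mod M -> M} :=
  fglift (id : M -> M).

Definition free_map (M N : lmodType R) (f : M -> N) :
  {linear free_mod M -> free_mod N} := fglift (fun x => << f x >>).

Lemma free_mapE (M N : lmodType R) (f : {linear M -> N}) x :
  free_eval N (free_map f x) = f (free_eval M x).
Proof.
pose l := free_eval N \o free_map f; pose r := f \o free_eval M.
apply: (@freeg_ext _ _ l r) => {}x /=.
by rewrite !liftU !scale1r /= liftU scale1r.
Qed.

End FreeModules.

Section Cohomology.
Variable R : comNzRingType.

Record cochain_complex := CochainComplex {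
  cochain :> nat -> lmodType R;
  cod : forall i, {linear cochain i -> cochain i.+1};
  cod_cod : forall i x, cod i.+1 (cod i x) = 0 }.

Record cochain_map (C D : cochain_complex) := CochainMap {
  cmap :> forall i, {linear C i -> D i};
  cmap_cod : forall i x, cmap i.+1 (cod C i x) = cod D i (cmap i x) }.

Fact zero_submod_subproof (M : lmodType R) : submod_set [set (0 : M)].
Proof. by split=> // r x y -> ->; rewrite scaler0 addr0. Qed.
Definition zero_submod (M : lmodType R) : submodClosed M :=
  submod_of (zero_submod_subproof M).

Fact trace_subproof (M : lmodType R) (A B : submodClosed M) :
  submod_set [set x : submodule A | val x \in B].
Proof.
have [B0 BD] := submodP B.
by split=> [|r x y /= Bx By]; [exact: B0 | exact: BD].
Qed.
(* A :&: B, as a submodule of the module A. *)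
Definition submod_trace (M : lmodType R) (A B : submodClosed M) :
  submodClosed (submodule A) := submod_of (trace_subproof A B).

Definition cocycles (C : cochain_complex) i : submodClosed (C i) := lin_ker (cod C i).

Definition coboundaries (C : cochain_complex) i : submodClosed (C i) :=
  if i is j.+1 then lin_im (cod C j) else zero_submod (C 0%N).

Definition cohomology (C : cochain_complex) i : lmodType R :=
  quotmod (submod_trace (cocycles C i) (coboundaries C i)).

Section Functoriality.
Variables (C D : cochain_complex) (u : cochain_map C D) (i : nat).

Fact cmap_cocycles x : x \in cocycles C i -> u i x \in cocycles D i.
Proof.
move=> /set_mem /= dx; apply/mem_set; rewrite /= -cmap_cod dx.
exact: linear0.
Qed.

Fact cmap_coboundaries x :
  x \in submod_trace (cocycles C i) (coboundaries C i) ->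
  submod_map cmap_cocycles x \in submod_trace (cocycles D i) (coboundaries D i).
Proof.
move=> /set_mem /= Bx; apply/mem_set => /=; move: (val x) Bx => {x}.
rewrite /coboundaries; case: i => [|j] x /set_mem /= => [->|[y _ <-]];
  apply/mem_set => /=; first exact: linear0.
by rewrite cmap_cod; exists (u j y).
Qed.

Definition cohomology_map : {linear cohomology C i -> cohomology D i} :=
  quot_map cmap_coboundaries.

End Functoriality.
End Cohomology.

Section Ext.
Variable R : comNzRingType.

Section Hom.
Variables (M N : lmodType R).
Fact hom_subproof : submod_set [set f : M -> N | linear f].
Proof.
split=> [r x y|a f g /= lf lg r x y]; first by rewrite /= scaler0 addr0.
rewrite !fctE lf lg !scalerDr !scalerA mulrC -!addrA; congr (_ + _).
by rewrite addrCA.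
Qed.
Definition hom : lmodType R := submodule (submod_of hom_subproof).

Lemma hom_linear (f : hom) : linear (val f).
Proof. exact: set_mem (valP f). Qed.
Definition hom_fun (f : hom) : {linear M -> N} :=
  HB.pack (val f) (GRing.isLinear.Build R M N _ (val f) (hom_linear f)).
End Hom.

Section HomPre.
Variables (M M' N : lmodType R) (g : {linear M' -> M}).
Fact hom_pre_subproof (f : hom M N) :
  (val f \o g) \in submod_of (hom_subproof M' N).
Proof.
by apply/mem_set => r x y /=; rewrite linearP (hom_linear f).
Qed.
Definition hom_pre (f : hom M N) : hom M' N :=
  exist _ (val f \o g) (hom_pre_subproof f).
Fact hom_pre_linear : linear hom_pre.
Proof. by move=> r x y; apply: val_inj; apply/funext. Qed.
HB.instance Definition _ :=
  GRing.isLinear.Build R (hom M N) (hom M' N) _ hom_pre hom_pre_linear.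
End HomPre.

(* The standard functorial free resolution
     ... -> R^(K_2) -> R^(K_1) -> R^(M) -> M -> 0,
   where K_0 = M, K_{i+1} = ker (R^(K_i) -> K_i) and R^(K) is the free module
   on the underlying set of K; it is exact by construction. *)
Fixpoint syzygy (M : lmodType R) (i : nat) : lmodType R :=
  if i is j.+1 then submodule (lin_ker (free_eval (syzygy M j))) else M.

Definition resolution (M : lmodType R) i : lmodType R := free_mod (syzygy M i).

Definition resolution_d (M : lmodType R) i :
    {linear resolution M i.+1 -> resolution M i} :=
  (\val : syzygy M i.+1 -> resolution M i) \o free_eval (syzygy M i.+1).

Fact resolution_dd M i x :
  resolution_d M i (resolution_d M i.+1 x) = 0.
Proof.
have /set_mem /= e := valP (free_eval (syzygy M i.+2) x).
by rewrite /= e.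
Qed.

Lemma free_map_ker (M M' : lmodType R) (f : {linear M -> M'}) x :
  x \in lin_ker (free_eval M) -> free_map f x \in lin_ker (free_eval M').
Proof.
move=> /set_mem /= x0; apply/mem_set; rewrite /= -[RHS](linear0 f) -x0.
exact: free_mapE.
Qed.

Fixpoint syzygy_map (M M' : lmodType R) (f : {linear M -> M'}) (i : nat) :
    {linear syzygy M i -> syzygy M' i} :=
  if i is j.+1 then submod_map (free_map_ker (syzygy_map f j)) else f.

Definition resolution_map (M M' : lmodType R) (f : {linear M -> M'}) i :
    {linear resolution M i -> resolution M' i} :=
  free_map (syzygy_map f i).

Fact resolution_map_d (M M' : lmodType R) (f : {linear M -> M'}) i x :
  resolution_map f i (resolution_d M i x)
  = resolution_d M' i (resolution_map f i.+1 x).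
Proof. by rewrite /resolution_d /= free_mapE. Qed.

Section ExtFunctor.
Variables (M N : lmodType R).

Fact hom_complex_cod_cod i (f : hom (resolution M i) N) :
  hom_pre (resolution_d M i.+1) (hom_pre (resolution_d M i) f) = 0
    :> hom (resolution M i.+2) N.
Proof.
apply: val_inj; apply/funext => x.
have /= -> := congr1 (val f) (resolution_dd x).
exact: linear0 (hom_fun f).
Qed.

Definition hom_complex : cochain_complex R :=
  CochainComplex hom_complex_cod_cod.

Definition ext (i : nat) : lmodType R := cohomology hom_complex i.

End ExtFunctor.

Section ExtMap.
Variables (M M' N : lmodType R) (f : {linear M' -> M}).

Fact hom_complex_map_cod i (h : hom_complex M N i) :
  hom_pre (resolution_map f i.+1) (cod (hom_complex M N) i h)
  = cod (hom_complex M' N) i (hom_pre (resolution_map f i) h).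
Proof.
apply: val_inj; apply/funext => x.
by have := congr1 (val (h : hom (resolution M i) N))
               (esym (resolution_map_d f x)).
Qed.

Definition hom_complex_map : cochain_map (hom_complex M N) (hom_complex M' N) :=
  @CochainMap R (hom_complex M N) (hom_complex M' N)
    (fun i => hom_pre (resolution_map f i)) hom_complex_map_cod.

Definition ext_map (i : nat) : {linear ext M N i -> ext M' N i} :=
  cohomology_map hom_complex_map i.

End ExtMap.
End Ext.

Section DirectLimit.
Variables (R : comNzRingType) (E : nat -> lmodType R).
Variable f : forall n, {linear E n -> E n.+1}.

Definition dprod := forall n, E n.
HB.instance Definition _ := gen_eqMixin dprod.
HB.instance Definition _ := gen_choiceMixin dprod.

Definition dprod0 : dprod := fun=> 0.
Definition dprodN (x : dprod) : dprod := fun n => - x n.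
Definition dprodD (x y : dprod) : dprod := fun n => x n + y n.
Definition dprodZ (r : R) (x : dprod) : dprod := fun n => r *: x n.

Fact dprodA : associative dprodD.
Proof. by move=> x y z; apply: functional_extensionality_dep => n; apply: addrA. Qed.
Fact dprodC : commutative dprodD.
Proof. by move=> x y; apply: functional_extensionality_dep => n; apply: addrC. Qed.
Fact dprod0D : left_id dprod0 dprodD.
Proof. by move=> x; apply: functional_extensionality_dep => n; apply: add0r. Qed.
Fact dprodND : left_inverse dprod0 dprodN dprodD.
Proof. by move=> x; apply: functional_extensionality_dep => n; apply: addNr. Qed.
HB.instance Definition _ :=
  GRing.isZmodule.Build dprod dprodA dprodC dprod0D dprodND.

Fact dprodZA r s x : dprodZ r (dprodZ s x) = dprodZ (r * s) x.
Proof. by apply: functional_extensionality_dep => n; apply: scalerA. Qed.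
Fact dprod1Z : left_id 1 dprodZ.
Proof. by move=> x; apply: functional_extensionality_dep => n; apply: scale1r. Qed.
Fact dprodZDr : right_distributive dprodZ +%R.
Proof. by move=> r x y; apply: functional_extensionality_dep => n; apply: scalerDr. Qed.
Fact dprodZDl x : {morph dprodZ^~ x : r s / r + s}.
Proof. by move=> r s; apply: functional_extensionality_dep => n; apply: scalerDl. Qed.
HB.instance Definition _ :=
  GRing.Zmodule_isLmodule.Build R dprod dprodZA dprod1Z dprodZDr dprodZDl.

Fact compatible_subproof :
  submod_set [set x : dprod | exists m, forall n, (m <= n)%N -> x n.+1 = f n (x n)].
Proof.
split; first by exists 0%N => n _; rewrite linear0.
move=> r x y [m xf] [m' yf]; exists (maxn m m') => n; rewrite geq_max.
by case/andP => mn m'n; rewrite linearP -xf // -yf.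
Qed.
Definition compatible : submodClosed dprod := submod_of compatible_subproof.

Fact ev_zero_subproof :
  submod_set [set x : dprod | exists m, forall n, (m <= n)%N -> x n = 0].
Proof.
split; first by exists 0%N.
move=> r x y [m x0] [m' y0]; exists (maxn m m') => n; rewrite geq_max.
case/andP => mn m'n; change (r *: x n + y n = 0).
by rewrite x0 // y0 // scaler0 addr0.
Qed.
Definition ev_zero : submodClosed dprod := submod_of ev_zero_subproof.

(* The direct limit of E_0 -> E_1 -> ...: sequences (x_n) with x_n in E_n that
   eventually satisfy x_{n+1} = f_n (x_n), modulo those that are eventually 0.
   The structure map [dirlim_in n] sends x to the class of
   (0, ..., 0, x, f_n x, f_{n+1} (f_n x), ...); [dirlim_inS], [dirlim_in_surj]
   and [dirlim_in0] below characterize the direct limit. *)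
Definition dirlim : lmodType R := quotmod (submod_trace compatible ev_zero).

Fixpoint dirlim_push n (x : E n) (m : nat) {struct m} : E m :=
  match n =P m with
  | ReflectT e => eq_rect n E x m e
  | ReflectF _ => if m is k.+1 then f k (dirlim_push x k) else 0
  end.

Lemma push_id n (x : E n) : dirlim_push x n = x.
Proof. by case: n x => [|n] x /=; case: eqP => // e; rewrite eq_axiomK. Qed.

Lemma pushS n (x : E n) m : (n <= m)%N -> dirlim_push x m.+1 = f m (dirlim_push x m).
Proof. by move=> nm /=; case: eqP => // e; rewrite e ltnn in nm. Qed.

Lemma push_small n (x : E n) m : (m < n)%N -> dirlim_push x m = 0.
Proof.
elim: m => [|m IHm] mn /=; case: eqP => e; do ?by rewrite e ltnn in mn.
  by [].
by rewrite IHm ?linear0 // ltnW.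
Qed.

Fact push_linear n m : linear (fun x : E n => dirlim_push x m).
Proof.
elim: m => [|m IHm] r x y /=; case: eqP => e; do ?by case: _ / e.
  by rewrite scaler0 addr0.
by rewrite IHm linearP.
Qed.

Fact push_compatible n (x : E n) : (dirlim_push x : dprod) \in compatible.
Proof. by apply/mem_set; exists n => m; apply: pushS. Qed.

Definition dirlim_in n (x : E n) : dirlim :=
  \pi_(quotmod _) (exist _ (dirlim_push x : dprod) (push_compatible x)
                   : submodule compatible).

Lemma dirlim_in_linear n : linear (@dirlim_in n).
Proof.
move=> r x y; rewrite /dirlim_in -pi_quot_linear; congr (\pi _).
by apply: val_inj; apply: functional_extensionality_dep => m; apply: push_linear.
Qed.

Lemma eq_dirlim (x y : submodule compatible) :
  \pi_dirlim x = \pi_dirlim y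
  <-> exists m, forall n, (m <= n)%N -> val x n = val y n.
Proof.
split=> [/eqP|[m xy]].
  rewrite eq_quotmod => /set_mem/set_mem[m xy]; exists m => n /xy.
  exact: subr0_eq.
apply/eqP; rewrite eq_quotmod; apply/mem_set/mem_set; exists m => n mn.
by change (val x n - val y n = 0); rewrite xy ?subrr.
Qed.

Lemma dirlim_in0 n (x : E n) :
  dirlim_in x = 0 <-> exists2 m, (n <= m)%N & dirlim_push x m = 0.
Proof.
rewrite -(pi_quot0 (submod_trace compatible ev_zero)).
apply: (iff_trans (eq_dirlim _ _)) => /=.
split=> [[m x0]|[m nm x0]].
  by exists (maxn n m); [exact: leq_maxl | apply: x0; exact: leq_maxr].
exists m; elim=> [|k IHk]; first by rewrite leqn0 => /eqP <-.
rewrite leq_eqVlt => /predU1P[<- //|mk]; rewrite pushS ?(leq_trans nm) //.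
by rewrite IHk ?linear0.
Qed.

Lemma dirlim_inS n (x : E n) : dirlim_in (f n x) = dirlim_in x.
Proof.
apply/eq_dirlim; exists n.+1.
suff fx k : (n < k)%N -> dirlim_push (f n x) k = dirlim_push x k by exact: fx.
elim: k => // k IHk; rewrite leq_eqVlt => /predU1P[[<-]|].
  by rewrite push_id pushS // push_id.
by rewrite ltnS => nk; rewrite !pushS ?IHk // ltnW.
Qed.

Lemma dirlim_in_surj (y : dirlim) : exists n (x : E n), dirlim_in x = y.
Proof.
elim/quotW: y => y; have /set_mem[m yf] := valP y.
exists m, (val y m); apply/eq_dirlim; exists m.
suff ym k : (m <= k)%N -> dirlim_push (val y m) k = val y k by exact: ym.
elim: k => [|k IHk]; first by rewrite leqn0 => /eqP ->; rewrite push_id.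
rewrite leq_eqVlt => /predU1P[<-|mk]; first by rewrite push_id.
by rewrite pushS // IHk // -yf.
Qed.

End DirectLimit.

(* [prime_idealr R] is not used: its type lives in the universe of [predType],
   so that [set (prime_idealr R)] is inconsistent with the universe constraints
   of finmap, on which algebra-tactics and the field library depend. *)
Record spec (R : comNzRingType) := Spec {
  spec_set :> set R;
  spec_submod : @submod_set R R^o spec_set;
  spec_proper : ~ spec_set 1;
  spec_prime : forall x y, spec_set (x * y) -> spec_set x \/ spec_set y }.

Lemma spec_inj (R : comNzRingType) (p q : spec R) :
  p = q :> set R -> p = q.
Proof.
case: p => p h1 h2 h3; case: q => q h1' h2' h3' /= e; subst q.
by rewrite (Prop_irrelevance h1 h1') (Prop_irrelevance h2 h2')
           (Prop_irrelevance h3 h3').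
Qed.

Definition ideal_of_spec (R : comNzRingType) (p : spec R) : submodClosed R^o :=
  submod_of (spec_submod p).
Coercion ideal_of_spec : spec >-> submodClosed.

Section Ideals.
Variable R : comNzRingType.

Section Module.
Variable M : lmodType R.

Fact span_subproof (X : set M) :
  submod_set [set x | forall L : submodClosed M, X `<=` [set` L] -> x \in L].
Proof.
split=> [L _|r x y Xx Xy L XL]; have [L0 LD] := submodP L; first exact: L0.
by apply: LD; [exact: Xx | exact: Xy].
Qed.
Definition gen_submod (X : set M) : submodClosed M := submod_of (span_subproof X).

Definition fin_gen (A : set M) : Prop :=
  exists s : seq M, A = [set` gen_submod [set` s]].

Fact bigcap_subproof (I : Type) (D : set I) (L : I -> submodClosed M) :
  submod_set (\bigcap_(i in D) [set` L i]).
Proof.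
split=> [i _|r x y Lx Ly i Di]; have [L0 LD] := submodP (L i); first exact: L0.
by apply: LD; [exact: Lx | exact: Ly].
Qed.
Definition bigcap_submod (I : Type) (D : set I) (L : I -> submodClosed M) :
  submodClosed M := submod_of (bigcap_subproof D L).

Fact ann_subproof : @submod_set R R^o [set r : R | forall x : M, r *: x = 0].
Proof.
split=> [x|r s t s0 t0 x]; first by rewrite scale0r.
by rewrite scalerDl t0 addr0 -[r *: s]/(r * s) -scalerA s0 scaler0.
Qed.
Definition Ann : submodClosed R^o := submod_of ann_subproof.

End Module.

Definition noetherian : Prop := forall I : submodClosed R^o, fin_gen [set` I].

Definition ideal_mul (I J : submodClosed R^o) : submodClosed R^o :=
  gen_submod [set (r * s : R^o) | r in [set` I] & s in [set` J]].

Fact setT_subproof (M : lmodType R) : submod_set [set: M].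
Proof. by []. Qed.

Definition ideal_pow (I : submodClosed R^o) (n : nat) : submodClosed R^o :=
  iter n (ideal_mul I) (submod_of (setT_subproof R^o)).

Lemma ideal_powS I n x : x \in ideal_pow I n.+1 -> x \in ideal_pow I n.
Proof.
move=> /set_mem /= Ix; apply: Ix => _ [r Ir [s Is <-]].
have [I0 ID] := submodP (ideal_pow I n).
by rewrite -[r * s]addr0; apply: ID.
Qed.

Definition Gamma (I : submodClosed R^o) (M : lmodType R) : set M :=
  \bigcup_(n in [set: nat])
    [set x | forall r, r \in ideal_pow I n -> r *: x = 0].

Definition Ass (M : lmodType R) : set (spec R) :=
  [set p : spec R | exists x : M, p = [set r | r *: x = 0] :> set R].

Definition primary_submod (M : lmodType R) (Q : submodClosed M) : Prop :=
  (exists x, x \notin Q) /\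
  forall (r : R) (x : M), r *: x \in Q ->
    x \in Q \/ exists k, forall y : M, r ^+ k *: y \in Q.

End Ideals.

Arguments Gamma {R} I M.
Arguments Ass {R} M.
Arguments Ann {R} M.

Record min_primary_decomposition (R : comNzRingType) (M : lmodType R) (n : nat)
    (N_ : 'I_n -> submodClosed M) (p_ : 'I_n -> spec R) : Prop := {
  mpd_primary : forall i, primary_submod (N_ i);
  mpd_ass : forall i, Ass (quotmod (N_ i)) = [set p_ i];
  mpd_zero : \bigcap_(i in [set: 'I_n]) [set` N_ i] = [set 0];
  (* no N_ j can be omitted from the intersection *)
  mpd_irredundant :
    forall j, \bigcap_(i in [set i | i <> j]) [set` N_ i] <> [set 0];
  mpd_distinct : injective p_ }.

Section Localization.
Variables (R : comNzRingType) (S : mulrClosed R) (M : lmodType R).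

Definition frac_equiv (u v : M * {s : R | s \in S}) : bool :=
  `[< exists2 w, w \in S & w *: (val v.2 *: u.1 - val u.2 *: v.1) = 0 >].

Fact frac_equiv_class : equiv_class_of frac_equiv.
Proof.
split=> [[x s]|[x s] [y r]|[y r] [x s] [z q]]; rewrite /frac_equiv /=.
- by apply/asboolP; exists 1; rewrite ?rpred1 // subrr scaler0.
- apply/asboolP/asboolP => -[w Sw e]; exists w => //;
  by rewrite -opprB scalerN e oppr0.
move=> /asboolP[w Sw e] /asboolP[w' Sw' e']; apply/asboolP.
exists (w * w' * val r); first by rewrite !rpredM // (valP r).
move: e e'; rewrite !scalerBr !scalerA => /eqP + /eqP.
rewrite !subr_eq0 => /eqP e /eqP e'; apply/eqP; rewrite subr_eq0; apply/eqP.
have -> : w * w' * val r * val q = (w' * val q) * (w * val r) by ring.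
have -> : w * w' * val r * val s = (w * val s) * (w' * val r) by ring.
by rewrite -scalerA e scalerA mulrC -scalerA e' scalerA.
Qed.

Canonical frac_equiv_rel := EquivRelPack frac_equiv_class.

Definition localization := {eq_quot frac_equiv}.
HB.instance Definition _ := EqQuotient.on localization.

Definition loc_frac (x : M) (s : {s : R | s \in S}) : localization :=
  \pi_localization (x, s).

(* Only the underlying set of S^-1 M, its canonical map and the subsets S^-1 L
   are needed, not the module structure. *)
Definition loc_map (x : M) : localization := loc_frac x (exist _ 1 (rpred1 S)).

Definition loc_set (L : set M) : set localization :=
  [set u | exists2 x, L x & exists s, u = loc_frac x s].

Lemma eq_frac x s y r :
  loc_frac x s = loc_frac y r
  <-> exists2 w, w \in S & w *: (val r *: x - val s *: y) = 0.
Proof.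
split=> [/eqmodP/asboolP//|e]; apply/eqmodP; exact/asboolP.
Qed.

Lemma loc_contractE (L : submodClosed M) x :
  loc_set [set` L] (loc_map x) <-> exists2 s, s \in S & s *: x \in L.
Proof.
have [L0 LD] := submodP L; split=> [[y Ly [s /eq_frac/= [w Sw]]]|[s Ss Lsx]].
  rewrite scale1r => /eqP; rewrite scalerBr subr_eq0 scalerA => /eqP e.
  exists (w * val s); first by rewrite rpredM // (valP s).
  by rewrite e -[_ *: y]addr0; exact: LD.
exists (s *: x) => //; exists (exist _ s Ss); apply/eq_frac.
by exists 1; rewrite ?rpred1 //= !scale1r subrr.
Qed.

Fact loc_contract_subproof (L : submodClosed M) :
  submod_set (loc_map @^-1` loc_set [set` L]).
Proof.
have [L0 LD] := submodP L; split=> [|r x y].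
  by apply/loc_contractE; exists 1; rewrite ?rpred1 // scaler0.
move=> /loc_contractE[s Ss Lsx] /loc_contractE[s' Ss' Lsy].
apply/loc_contractE; exists (s * s'); first exact: rpredM.
have -> : (s * s') *: (r *: x + y)
    = (s' * r) *: (s *: x) + (s *: (s' *: y) + 0).
  by rewrite addr0 scalerDr !scalerA; congr (_ *: _ + _); ring.
by apply: (LD) => //; apply: LD.
Qed.

(* C_S^M(L) *)
Definition loc_contract (L : submodClosed M) : submodClosed M :=
  submod_of (loc_contract_subproof L).

End Localization.

Section PrimeComplements.
Variable R : comNzRingType.

Fact compl_union_subproof (D : set (spec R)) :
  mulr_closed (mem (~` \bigcup_(p in D) p) : {pred R}).
Proof.
split.
  by apply/mem_set => -[p _]; apply: spec_proper.
move=> x y /set_mem Dx /set_mem Dy; apply/mem_set => -[p Dp].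
by case/spec_prime => [xp|yp]; [apply: Dx|apply: Dy]; exists p.
Qed.
(* R \ \bigcup_(p in D) p *)
Definition compl_union (D : set (spec R)) : mulrClosed R :=
  HB.pack (mem (~` \bigcup_(p in D) p) : {pred R})
    (GRing.isMulClosed.Build R _ (compl_union_subproof D)).

Fact compl_prime_subproof (p : spec R) :
  mulr_closed (mem (~` p) : {pred R}).
Proof.
split.
  by apply/mem_set; apply: spec_proper.
move=> x y /set_mem px /set_mem py; apply/mem_set.
by case/spec_prime.
Qed.
Definition compl_prime (p : spec R) : mulrClosed R :=
  HB.pack (mem (~` p) : {pred R})
    (GRing.isMulClosed.Build R _ (compl_prime_subproof p)).

(* C_p^M(L), with no restriction to p in Supp M. *)
Definition contract_at (p : spec R) (M : lmodType R) (L : submodClosed M) :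
  submodClosed M := loc_contract (compl_prime p) L.

End PrimeComplements.

Section LocalCohomology.
Variables (R : comNzRingType) (a : submodClosed R^o).

(* The canonical projection R/a^(n+1) -> R/a^n. *)
Definition quot_pow_proj n :
    {linear quotmod (ideal_pow a n.+1) -> quotmod (ideal_pow a n)} :=
  quot_map (f := idfun) (@ideal_powS R a n).

Definition local_cohomology (i : int) (M : lmodType R) : lmodType R :=
  match i with
  | Posz k =>
      dirlim (fun n => ext_map M (quot_pow_proj n) k)
  | Negz _ => 'rV[R]_0
  end.

(* [supremum x0 A] is x0 when A is empty, hence cohom_dim M = -oo if all the
   local cohomology modules of M vanish. *)
Definition cohom_dim (M : lmodType R) : \bar int :=
  supremum -oo%E
    [set i%:E%E | i in [set i : int |
       0 <= i /\ exists x : local_cohomology i M, x != 0]].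

Definition Delta (M : lmodType R) (t : int) : set (spec R) :=
  [set p : spec R | Ass M p /\ (t%:E <= cohom_dim (quotmod p))%E].

(* The ideal a(t) attached to M. *)
Definition ideal_at (M : lmodType R) (t : int) : submodClosed R^o :=
  bigcap_submod [set p : spec R | Ass M p /\ (cohom_dim (quotmod p) < t%:E)%E]
    (@ideal_of_spec R).

End LocalCohomology.

(* Main.v *)
Require Import Defs.
From HB Require Import structures.
From mathcomp Require Import all_boot all_order all_algebra generic_quotient.
From mathcomp Require Import boolp classical_sets constructive_ereal.
From mathcomp Require Import ring.
From mathcomp.multinomials Require Import freeg.

(* Local cohomology vanishes in all degrees above the number of generators of
   [a]: writing a = b + (x), the exact sequences
   0 -> R/(b^n : x^n) -> R/b^n -> R/(b^n + x^n) -> 0, together with the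
   stabilization of (b^n : x^k) in k, show that the maps R/a^m -> R/a^n kill Ext
   in one degree more than those for b do.

   Hence, by descending induction on i, if H^j(M) = 0 for all j >= i with M
   finitely generated, then H^i(R/q) = 0 for every prime q containing Ann M:
   H^i is right exact on modules killed by Ann M, there is a nonzero map from M
   to R/q, its image has vanishing H^i, and the quotient of R/q by this image is
   filtered by modules R/q' with q' strictly larger than q.

   So Delta(t) is closed under passing to smaller associated primes, which with
   prime avoidance makes a(t) meet S(t), and the equalities (i) become a cycle of
   inclusions. For (ii), L in Gamma_{a(t)}(N) is filtered by modules R/q with q
   containing some p in Ass N with cd(R/p) < t; conversely an x in L whose
   annihilator lies in some p in Delta(t) would force cd(R/p) < t. For (iii), r
   in the left-hand side factors on N through K = C_{S(t)}(0), and H^t(K) = 0. *)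

Set Implicit Arguments.
Unset Strict Implicit.
Unset Printing Implicit Defensive.

Import GRing.Theory.
Local Open Scope ring_scope.
Local Open Scope classical_set_scope.
Local Open Scope quotient_scope.

(** * Linear maps from graphs, projective modules and short exact sequences *)

Section LinearMaps.
Variable R : comNzRingType.
Implicit Types A B K P Q X Y : lmodType R.

(** Two values over one argument differ by a value over 0, so single-valuedness only has to be
    tested at 0. Many linear maps below are specified by such a graph rather than by a chosen
    function. *)
Lemma linear_of_rel A B (T : A -> B -> Prop) :
  (forall x, exists y, T x y) ->
  (forall r x y x' y', T x y -> T x' y' -> T (r *: x + x') (r *: y + y')) ->
  (forall y, T 0 y -> y = 0) ->
  exists f : {linear A -> B}, forall x, T x (f x).
Proof.
move=> /choice[f Tf] TD T0.
have lf : linear f.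
  move=> r x y; apply/eqP; rewrite -subr_eq0; apply/eqP/T0.
  rewrite -(subrr (r *: x + y)) [X in T X]addrC [X in T _ X]addrC -!scaleN1r.
  by apply: (TD) => //; apply: (TD).
pose g : {linear A -> B} := HB.pack f (GRing.isLinear.Build R A B _ f lf).
by exists g.
Qed.

Lemma corestrict X Y (L : submodClosed Y) (f : {linear X -> Y}) :
  (forall x, f x \in L) ->
  exists g : {linear X -> submodule L}, forall x, val (g x) = f x.
Proof.
move=> fL; apply: (@linear_of_rel _ _ (fun x y => val y = f x))
  => [x|r x y x' y' /= yE y'E|y] /=.
- by exists (Sub (f x) (fL x)).
- by rewrite yE y'E linearP.
- by rewrite linear0 => y0; apply: val_inj.
Qed.

Definition in_submodule X (L : submodClosed X) x (xL : x \in L) : submodule L :=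
  exist _ x xL.

Definition onto A B (f : A -> B) := forall y, exists x, f x = y.

Definition projective P := forall X Q (e : {linear X -> Q}), onto e ->
  forall f : {linear P -> Q}, exists g : {linear P -> X}, forall z, e (g z) = f z.

Lemma free_eval1 A (x : A) : free_eval A << x >> = x.
Proof. by rewrite /= liftU scale1r. Qed.

Lemma free_eval_surj A : onto (free_eval A).
Proof. by move=> x; exists << x >>; rewrite free_eval1. Qed.

Lemma onto_free_eval A B (e : {linear A -> B}) : onto e -> onto (e \o free_eval A).
Proof.
by move=> se y; have [x <-] := se y; exists << x >>; rewrite /= free_eval1.
Qed.

Lemma free_mod_projective A : projective (free_mod A).
Proof.
move=> X Q e /choice[s sK] f; exists (fglift (fun x : A => s (f << x >>))) => z.
pose g := e \o fglift (fun x : A => s (f << x >>)).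
by apply: (@freeg_ext _ _ _ g f) => x; rewrite /g /= liftU scale1r sK.
Qed.

Lemma free_map_comp A B X (f : B -> X) (g : A -> B) (h : A -> X) :
  (forall x, h x = f (g x)) ->
  forall z, free_map h z = free_map f (free_map g z).
Proof.
move=> hE z; pose k := free_map f \o free_map g.
apply: (@freeg_ext _ _ _ (free_map h) k) => x.
by rewrite /k /= !liftU !scale1r liftU scale1r hE.
Qed.

Lemma prod_projective P Q : projective P -> projective Q ->
  projective (P * Q)%type.
Proof.
move=> hP hQ X Y e se f.
have [f1 f1E] : exists f1 : {linear P -> Y}, forall p, f1 p = f (p, 0).
  apply: (@linear_of_rel _ _ (fun p y => y = f (p, 0))) => [x|r x y x' y' -> ->|y ->].
  - by exists (f (x, 0)).
  - by rewrite -linearP; congr (f (_, _)); rewrite /= scaler0 addr0.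
  - exact: linear0.
have [f2 f2E] : exists f2 : {linear Q -> Y}, forall p, f2 p = f (0, p).
  apply: (@linear_of_rel _ _ (fun p y => y = f (0, p))) => [x|r x y x' y' -> ->|y ->].
  - by exists (f (0, x)).
  - by rewrite -linearP; congr (f (_, _)); rewrite /= scaler0 addr0.
  - exact: linear0.
have [g1 g1E] := hP _ _ _ se f1; have [g2 g2E] := hQ _ _ _ se f2.
have [g gE] : exists g : {linear (P * Q)%type -> X}, forall z, g z = g1 z.1 + g2 z.2.
  apply: (@linear_of_rel _ _ (fun z x => x = g1 z.1 + g2 z.2))
    => [x|r x y x' y' -> ->|y ->].
  - by eexists.
  - by rewrite /= !linearP scalerDr addrACA.
  - by rewrite /= !linear0 addr0.
exists g => -[p q]; rewrite gE /= linearD g1E g2E f1E f2E -linearD.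
by congr (f (_, _)); rewrite ?addr0 ?add0r.
Qed.

Record sexact K P A (j : {linear K -> P}) (e : {linear P -> A}) : Prop := {
  sexact_inj : forall x, j x = 0 -> x = 0;
  sexact_ker : forall p, e p = 0 -> exists x, j x = p;
  sexact_im : forall x, e (j x) = 0;
  sexact_surj : onto e }.

Lemma sexact_lin_ker P A (e : {linear P -> A}) : onto e ->
  sexact (\val : submodule (lin_ker e) -> P) e.
Proof.
move=> se; split => // [x x0|p p0|x].
- exact: val_inj.
- have pK : p \in lin_ker e by apply/mem_set.
  by exists (Sub p pK).
- exact: set_mem (valP x).
Qed.

Lemma lift_ker K P A (j : {linear K -> P}) (e : {linear P -> A}) X
    (f : {linear X -> P}) :
  sexact j e -> (forall x, e (f x) = 0) ->
  exists g : {linear X -> K}, forall x, j (g x) = f x.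
Proof.
move=> se ef; apply: (@linear_of_rel X K (fun x y => j y = f x))
  => [x|r x y x' y' yE y'E|y].
- exact: (sexact_ker se).
- by rewrite linearP yE y'E linearP.
- by rewrite linear0; exact: (sexact_inj se).
Qed.

End LinearMaps.

(** * Maps inducing zero on Ext, tested on syzygies *)

Section NullMaps.
Variable R : comNzRingType.
Implicit Types A B C K L P X : lmodType R.

(** [u] is a bare function so that differences of linear maps can be inserted directly. By
    [factors_projective] any projective module may replace the canonical cover [free_mod A]. *)
Definition factors_free A' A (u : A' -> A) : Prop :=
  exists h : {linear A' -> free_mod A}, forall x, u x = free_eval A (h x).

(* [null i u] holds iff u induces 0 on Ext^(i+1)(-, X) for every X. *)
Fixpoint null i A' A (u : {linear A' -> A}) : Prop :=
  if i is j.+1 then null j (syzygy_map u 1) else factors_free u.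

Lemma factors_projective P A' A (u : A' -> A) (b : {linear P -> A})
    (a : {linear A' -> P}) :
  projective P -> (forall x, u x = b (a x)) -> factors_free u.
Proof.
move=> hP uE; have [g gE] := hP _ _ _ (@free_eval_surj R A) b.
by exists (g \o a) => x; rewrite uE -gE.
Qed.

(** If v - u is [free_eval A \o h], then [free_map v \- free_map u \- (h \o free_eval A')] takes
    values in the syzygy of [A]. On the syzygy of [A'] the last term vanishes, so the two syzygy
    maps again differ by a map through a free module. *)
Lemma null_perturb i A' A (u v : {linear A' -> A}) :
  factors_free (fun x => v x - u x) -> null i u -> null i v.
Proof.
elim: i A' A u v => [|i IHi] A' A u v [h hE] /=.
  by case=> k kE; exists (h \+ k) => x /=; rewrite linearD /= -hE -kE subrK.
apply: IHi; pose k := free_map v \- free_map u \- (h \o free_eval A').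
have [|g gE] := @corestrict _ _ _ (lin_ker (free_eval A)) k.
  move=> z; apply/mem_set; rewrite /= !linearB /= !free_mapE -hE.
  by rewrite subrr.
apply: (@factors_projective (free_mod A') _ _ _ g \val).
  exact: free_mod_projective.
move=> x; apply: val_inj; rewrite gE /= /k /=.
have /set_mem /= -> := valP x.
by rewrite linear0 subr0.
Qed.

Lemma null_comp i A'' A' A B (a : {linear A'' -> A'}) (u : {linear A' -> A})
    (b : {linear A -> B}) (w : {linear A'' -> B}) :
  (forall x, w x = b (u (a x))) -> null i u -> null i w.
Proof.
elim: i A'' A' A B a u b w => [|i IHi] A'' A' A B a u b w wE /=.
  case=> h hE; apply: (@factors_projective (free_mod A) _ _ _ (b \o free_eval A) (h \o a)).
    exact: free_mod_projective.
  by move=> x; rewrite wE hE.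
apply: (IHi _ _ _ _ (syzygy_map a 1) _ (syzygy_map b 1)) => x.
apply: val_inj => /=.
rewrite (@free_map_comp _ _ _ _ b (u \o a) w) //.
by rewrite (@free_map_comp _ _ _ _ u a).
Qed.

(** A factorization of [u] through [free_eval A] corrects [free_map u] to a map from the whole free
    module to the syzygy of [A], and this map extends the syzygy map of [u]. *)
Lemma nullS i A' A (u : {linear A' -> A}) : null i u -> null i.+1 u.
Proof.
elim: i A' A u => [|i IHi] A' A u; last exact: IHi.
case=> h hE; pose k := free_map u \- (h \o free_eval A').
have [|g gE] := @corestrict _ _ _ (lin_ker (free_eval A)) k.
  by move=> z; apply/mem_set; rewrite /= linearB /= free_mapE -hE subrr.
apply: (@factors_projective (free_mod A') _ _ _ g \val).
  exact: free_mod_projective.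
move=> x; apply: val_inj; rewrite gE /= /k /=.
have /set_mem /= -> := valP x.
by rewrite linear0 subr0.
Qed.

Lemma null_syzygy_map i j A' A (u : {linear A' -> A}) :
  null (i + j) u -> null i (syzygy_map u j).
Proof.
elim: j i => [|j IHj] i; first by rewrite addn0.
by rewrite addnS -addSn => /IHj.
Qed.

Section Covers.
Variables (K' P' A' K P A : lmodType R).
Variables (j' : {linear K' -> P'}) (e' : {linear P' -> A'}).
Variables (j : {linear K -> P}) (e : {linear P -> A}).
Hypotheses (se' : sexact j' e') (se : sexact j e).
Variables (k : {linear K' -> K}) (p : {linear P' -> P}) (u : {linear A' -> A}).
Hypotheses (pj : forall x, p (j' x) = j (k x)) (ep : forall x, e (p x) = u (e' x)).

Let se_free X := sexact_lin_ker (@free_eval_surj R X).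

(** Dimension shifting along arbitrary covers: comparison maps with the canonical covers turn [k]
    into the syzygy map of [u], up to a map through a free module. Projectivity of [P] yields the
    comparison map from [P] to [free_mod A]. *)
Lemma null_cover i : projective P -> null i k -> null i.+1 u.
Proof.
move=> hP nk.
have [al alE] := free_mod_projective (sexact_surj se') (free_eval A').
have [be beE] := hP _ _ _ (@free_eval_surj R A) e.
have [|aK aKE] := lift_ker (f := al \o (\val : syzygy A' 1 -> _)) se'.
  by move=> x; rewrite /= alE (sexact_im (se_free A')).
have [|bK bKE] := lift_ker (f := be \o j) (se_free A).
  by move=> x; rewrite /= beE (sexact_im se).
pose g := free_map u \- (be \o p \o al).
have [|ga gaE] := lift_ker (f := g) (se_free A).
  by move=> x; rewrite /g /= linearB /= free_mapE beE ep alE subrr.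
have := null_comp (w := bK \o k \o aK) (fun=> erefl) nk.
apply: null_perturb; apply: (@factors_projective (free_mod A') _ _ _ ga \val).
  exact: free_mod_projective.
move=> x; apply: val_inj; rewrite gaE /= /g /=; congr (_ - _).
by apply: etrans (bKE _) _; rewrite /= -pj aKE.
Qed.

(** The comparison maps now run in the opposite directions, so it is [P'] that must be projective;
    the correction term factors through [P']. *)
Lemma null_uncover i : projective P' -> null i.+1 u -> null i k.
Proof.
move=> hP nu.
have [al alE] := hP _ _ _ (@free_eval_surj R A') e'.
have [be beE] := free_mod_projective (sexact_surj se) (free_eval A).
have [|aK aKE] := lift_ker (f := al \o j') (se_free A').
  by move=> x; rewrite /= alE (sexact_im se').
have [|bK bKE] := lift_ker (f := be \o (\val : syzygy A 1 -> _)) se.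
  by move=> x; rewrite /= beE (sexact_im (se_free A)).
pose g := p \- (be \o free_map u \o al).
have [|ga gaE] := lift_ker (f := g) se.
  by move=> x; rewrite /g /= linearB /= beE free_mapE alE ep subrr.
have := null_comp (w := bK \o syzygy_map u 1 \o aK) (fun=> erefl) nu.
apply: null_perturb; apply: (@factors_projective P' _ _ _ ga j') => // x.
apply/eqP; rewrite -subr_eq0; apply/eqP/(sexact_inj se).
rewrite !linearB /= gaE /g /= bKE /= pj; apply/eqP; rewrite subr_eq0; apply/eqP.
by congr (_ - be (free_map u _)); exact: (aKE x).
Qed.

End Covers.
End NullMaps.

(** * Null maps in ladders of short exact sequences *)

Section Ladders.
Variable R : comNzRingType.
Implicit Types A B C K L M P X Y : lmodType R.

Lemma linear_prod_map A B X Y (f : {linear A -> X}) (g : {linear B -> Y}) :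
  exists h : {linear (A * B)%type -> (X * Y)%type},
    forall z, h z = (f z.1, g z.2).
Proof.
apply: (@linear_of_rel _ _ _ (fun z w => w = (f z.1, g z.2))).
- by move=> z; eexists.
- by move=> r z w z' w' -> ->; rewrite /= !linearP.
- by move=> w ->; rewrite /= !linear0.
Qed.

Lemma linear_pairing A B X (f : {linear A -> X}) (g : {linear B -> X}) :
  exists h : {linear (A * B)%type -> X}, forall z, h z = f z.1 + g z.2.
Proof.
apply: (@linear_of_rel _ _ _ (fun z w => w = f z.1 + g z.2)).
- by move=> z; eexists.
- by move=> r z w z' w' -> ->; rewrite /= !linearP scalerDr addrACA.
- by move=> w ->; rewrite /= !linear0 addr0.
Qed.

(* F(L) covers A and F(K) + F(L) covers L; unlike F(K) -> F(L) -> F(A), these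
   covers of K, L, A form an exact sequence, hence so do their kernels. *)
Lemma horseshoe K L A (j : {linear K -> L}) (e : {linear L -> A}) :
  sexact j e ->
  exists (q : {linear (free_mod K * free_mod L)%type -> L})
    (i : {linear syzygy K 1 -> submodule (lin_ker q)})
    (p : {linear submodule (lin_ker q)
            -> submodule (lin_ker (e \o free_eval L))}),
  [/\ forall z, q z = j (free_eval K z.1) + free_eval L z.2,
      forall x, val (i x) = (val x, 0),
      forall z, val (p z) = (val z).2 & sexact i p].
Proof.
move=> se; have [q qE] := linear_pairing (j \o free_eval K) (free_eval L).
exists q.
have [i iE] : exists i : {linear syzygy K 1 -> submodule (lin_ker q)},
    forall x, val (i x) = (val x, 0).
  apply: (@linear_of_rel _ _ _ (fun x y => val y = (val x, 0))) => [x|r x y x' y'|y].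
  - have xq : (val x, 0) \in lin_ker q.
      apply/mem_set; rewrite /= qE /=; have /set_mem /= -> := valP x.
      by rewrite !linear0 addr0.
    by exists (in_submodule xq).
  - move=> /= -> ->; rewrite -[r *: (_, _)]/(_, _) -[(_, _) + _]/(_, _) /=.
    by rewrite scaler0 addr0.
  - by move=> y0; apply: val_inj.
have [p pE] : exists p : {linear submodule (lin_ker q)
      -> submodule (lin_ker (e \o free_eval L))}, forall z, val (p z) = (val z).2.
  apply: (@linear_of_rel _ _ _ (fun z y => val y = (val z).2)) => [z|r x y x' y'|y].
  - have zq : (val z).2 \in lin_ker (e \o free_eval L).
      apply/mem_set; have /set_mem /= := valP z; rewrite qE => /(congr1 e).
      by rewrite linearD /= (sexact_im se) add0r linear0.
    by exists (in_submodule zq).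
  - by move=> /= -> ->.
  - by move=> y0; apply: val_inj.
exists i, p; split=> //; split=> [x|z|x|y].
- by move=> /(congr1 val); rewrite iE => -[x0]; apply: val_inj.
- move=> /(congr1 val); rewrite pE /= => z2.
  have := set_mem (valP z); rewrite /= qE /= z2 linear0 addr0.
  move=> /(sexact_inj se) z1; have xK : (val z).1 \in lin_ker (free_eval K).
    exact/mem_set.
  exists (in_submodule xK); apply: val_inj; rewrite iE /=.
  by rewrite -z2; case: (sval z).
- by apply: val_inj; rewrite pE iE.
have /set_mem /= /(sexact_ker se)[x xE] := valP y.
have zq : (- << x >>, val y) \in lin_ker q.
  by apply/mem_set; rewrite /= qE /= !linearN free_eval1 xE addNr.
by exists (in_submodule zq); apply: val_inj; rewrite pE.
Qed.

(** This is exactness of Ext at the middle term: pulled back along [l2], a class restricts to zero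
    on [K2], hence comes from [A2], and [a1] kills it. The induction passes to syzygies, for which
    [horseshoe] supplies the exact sequences of kernels. *)
Lemma null_mid i K1 L1 A1 K2 L2 A2 K3 L3 A3
    (j1 : {linear K1 -> L1}) (e1 : {linear L1 -> A1})
    (j2 : {linear K2 -> L2}) (e2 : {linear L2 -> A2})
    (j3 : {linear K3 -> L3}) (e3 : {linear L3 -> A3})
    (l1 : {linear L1 -> L2}) (a1 : {linear A1 -> A2})
    (k2 : {linear K2 -> K3}) (l2 : {linear L2 -> L3}) :
  sexact j1 e1 -> sexact j2 e2 -> sexact j3 e3 ->
  (forall x, e2 (l1 x) = a1 (e1 x)) -> (forall x, l2 (j2 x) = j3 (k2 x)) ->
  null i a1 -> null i k2 -> null i (l2 \o l1).
Proof.
elim: i K1 L1 A1 K2 L2 A2 K3 L3 A3 j1 e1 j2 e2 j3 e3 l1 a1 k2 l2 => [|i IHi]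
  K1 L1 A1 K2 L2 A2 K3 L3 A3 j1 e1 j2 e2 j3 e3 l1 a1 k2 l2 se1 se2 se3 el lj.
  move=> [h hE] nk.
  have [s sE] := free_mod_projective (sexact_surj se2) (free_eval A2).
  (* [l1] is the sum of [s \o h \o e1], which passes through a free module, and of a map into [K2],
     to which nullity of [k2] applies. *)
  have [|g gE] := lift_ker (f := l1 \- (s \o h \o e1)) se2.
    by move=> x; rewrite /= linearB /= sE -hE el subrr.
  have := null_comp (w := j3 \o k2 \o g) (fun=> erefl) nk.
  apply: null_perturb.
  apply: (@factors_projective _ (free_mod A2) _ _ _ (l2 \o s) (h \o e1)).
    exact: free_mod_projective.
  by move=> x /=; rewrite -lj gE /= linearB /= opprB addrC subrK.
have [k1 k1E] : exists k1 : {linear K1 -> K2}, forall x, j2 (k1 x) = l1 (j1 x).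
  by apply: (lift_ker (f := l1 \o j1) se2) => x; rewrite /= el (sexact_im se1) linear0.
move=> na nk.
have [q1 [i1 [p1 [q1E i1E p1E s1]]]] := horseshoe se1.
have [q2 [i2 [p2 [q2E i2E p2E s2]]]] := horseshoe se2.
have [q3 [i3 [p3 [q3E i3E p3E s3]]]] := horseshoe se3.
have [f1 f1E] := linear_prod_map (free_map k1) (free_map l1).
have [f2 f2E] := linear_prod_map (free_map k2) (free_map l2).
have qf1 z : q2 (f1 z) = l1 (q1 z).
  by rewrite q1E q2E f1E /= !free_mapE k1E linearD.
have qf2 z : q3 (f2 z) = l2 (q2 z).
  by rewrite q3E q2E f2E /= !free_mapE -lj linearD.
have [|g1 g1E] := corestrict (f := f1 \o (\val : submodule (lin_ker q1) -> _))
    (L := lin_ker q2).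
  by move=> x; apply/mem_set; rewrite /= qf1 (set_mem (valP x)) linear0.
have [|g2 g2E] := corestrict (f := f2 \o (\val : submodule (lin_ker q2) -> _))
    (L := lin_ker q3).
  by move=> x; apply/mem_set; rewrite /= qf2 (set_mem (valP x)) linear0.
have [|m1 m1E] := corestrict (L := lin_ker (e2 \o free_eval L2))
  (f := free_map l1 \o (\val : submodule (lin_ker (e1 \o free_eval L1)) -> _)).
  move=> x; apply/mem_set; rewrite /= free_mapE el.
  by have /set_mem /= -> := valP x; rewrite linear0.
have qs K L (j : {linear K -> L})
    (q : {linear (free_mod K * free_mod L)%type -> L}) :
    (forall z, q z = j (free_eval K z.1) + free_eval L z.2) -> onto q.
  by move=> qE y; exists (0, << y >>); rewrite qE /= !linear0 add0r free_eval1.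
apply: (null_cover (sexact_lin_ker (qs _ _ _ _ q1E))
          (sexact_lin_ker (qs _ _ _ _ q3E)) (k := g2 \o g1) (p := f2 \o f1)).
- by move=> x; rewrite /= (g2E _) /=  (g1E _).
- by move=> x; rewrite /= qf2 qf1.
- by apply: prod_projective; exact: free_mod_projective.
apply: (IHi _ _ _ _ _ _ _ _ _ _ _ _ _ _ _ g1 m1 (syzygy_map k2 1) g2 s1 s2 s3).
- move=> x; apply: val_inj; apply: etrans (p2E _) _; rewrite g1E /= f1E /=.
  by apply: esym; apply: etrans (m1E _) _; rewrite /= -(p1E x).
- move=> x; apply: val_inj; apply: etrans (g2E _) _.
  apply: etrans (congr1 f2 (i2E x)) _; apply: esym; apply: etrans (i3E _) _.
  by rewrite f2E /= linear0.
- apply: (null_uncover (sexact_lin_ker (onto_free_eval (sexact_surj se1)))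
    (sexact_lin_ker (onto_free_eval (sexact_surj se2))) (p := free_map l1)
    _ _ _ na).
  + by move=> x; exact: esym (m1E x).
  + by move=> x; rewrite /= free_mapE.
  + exact: free_mod_projective.
exact: nk.
Qed.

(** Exactness of Ext^(i+1)(A) -> Ext^(i+2)(C) -> Ext^(i+2)(B), reduced to [null_mid] by rotation:
    the kernel of [free_mod B] -> C is an extension of A by the first syzygy of B, and its Ext is
    that of C one degree higher. *)
Lemma null_ladder i A1 B1 C1 A2 B2 C2 A3 B3 C3
    (j1 : {linear A1 -> B1}) (e1 : {linear B1 -> C1})
    (j2 : {linear A2 -> B2}) (e2 : {linear B2 -> C2})
    (j3 : {linear A3 -> B3}) (e3 : {linear B3 -> C3})
    (a1 : {linear A1 -> A2}) (b1 : {linear B1 -> B2}) (c1 : {linear C1 -> C2})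
    (b2 : {linear B2 -> B3}) (c2 : {linear C2 -> C3}) :
  sexact j1 e1 -> sexact j2 e2 -> sexact j3 e3 ->
  (forall x, b1 (j1 x) = j2 (a1 x)) ->
  (forall x, c1 (e1 x) = e2 (b1 x)) -> (forall x, c2 (e2 x) = e3 (b2 x)) ->
  null i a1 -> null i.+1 b2 -> null i.+1 (c2 \o c1).
Proof.
move=> se1 se2 se3 bj ce1 ce2 na nb.
have cov A B C (j : {linear A -> B}) (e : {linear B -> C}) : sexact j e ->
  exists (i : {linear syzygy B 1 -> submodule (lin_ker (e \o free_eval B))})
    (p : {linear submodule (lin_ker (e \o free_eval B)) -> A}),
    [/\ sexact i p, forall x, val (i x) = val x &
        forall x, j (p x) = free_eval B (val x)].
  move=> se.
  have [|i0 i0E] := corestrict (L := lin_ker (e \o free_eval B))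
      (f := (\val : syzygy B 1 -> free_mod B)).
    by move=> x; apply/mem_set; rewrite /= (set_mem (valP x)) linear0.
  have [|p pE] := lift_ker (f := free_eval B \o
      (\val : submodule (lin_ker (e \o free_eval B)) -> _)) se.
    by move=> x; exact: set_mem (valP x).
  exists i0, p; split=> //; split=> [x x0|z z0|x|y].
  - by apply: val_inj; rewrite -(i0E x) x0.
  - have zK : val z \in lin_ker (free_eval B).
      by apply/mem_set; have := pE z; rewrite z0 linear0.
    by exists (in_submodule zK); apply: val_inj; rewrite i0E.
  - apply: (sexact_inj se); rewrite pE /= (i0E x).
    exact: set_mem (valP x).
  - have yL : << j y >> \in lin_ker (e \o free_eval B).
      by apply/mem_set; rewrite /= free_eval1 (sexact_im se).
    exists (in_submodule yL); apply/eqP; rewrite -subr_eq0; apply/eqP/(sexact_inj se).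
    by rewrite linearB /= pE /= free_eval1 subrr.
have [i1 [p1 [s1 i1E p1E]]] := cov _ _ _ _ _ se1.
have [i2 [p2 [s2 i2E p2E]]] := cov _ _ _ _ _ se2.
have [i3 [p3 [s3 i3E p3E]]] := cov _ _ _ _ _ se3.
have [|l1 l1E] := corestrict (L := lin_ker (e2 \o free_eval B2))
  (f := free_map b1 \o (\val : submodule (lin_ker (e1 \o free_eval B1)) -> _)).
  move=> x; apply/mem_set; rewrite /= free_mapE -ce1.
  by have /set_mem /= -> := valP x; rewrite linear0.
have [|l2 l2E] := corestrict (L := lin_ker (e3 \o free_eval B3))
  (f := free_map b2 \o (\val : submodule (lin_ker (e2 \o free_eval B2)) -> _)).
  move=> x; apply/mem_set; rewrite /= free_mapE -ce2.
  by have /set_mem /= -> := valP x; rewrite linear0.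
apply: (null_cover (sexact_lin_ker (onto_free_eval (sexact_surj se1)))
  (sexact_lin_ker (onto_free_eval (sexact_surj se3))) (k := l2 \o l1)
  (p := free_map b2 \o free_map b1)).
- by move=> x; rewrite /= (l2E _) /= (l1E _).
- by move=> x; rewrite /= !free_mapE ce1 ce2.
- exact: free_mod_projective.
apply: (null_mid (a1 := a1) (k2 := syzygy_map b2 1) s1 s2 s3) => //.
- move=> x; apply/eqP; rewrite -subr_eq0; apply/eqP/(sexact_inj se2).
  by rewrite linearB /= p2E (l1E _) /= free_mapE -bj p1E subrr.
- move=> x; apply: val_inj; apply: etrans (l2E _) _.
  apply: etrans (congr1 (free_map b2) (i2E x)) _.
  by apply: esym; exact: i3E.
Qed.

End Ladders.

(** * Cochains on the standard resolution *)

Section ResolutionMaps.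
Variable R : comNzRingType.
Implicit Types A B C X : lmodType R.

Lemma syzygy_map_comp i A B C (f : {linear B -> C}) (g : {linear A -> B})
    (h : {linear A -> C}) :
  (forall x, h x = f (g x)) ->
  forall z, syzygy_map h i z = syzygy_map f i (syzygy_map g i z).
Proof.
move=> hE; elim: i => [|i IHi] //= z; apply: val_inj => /=.
by rewrite (free_map_comp IHi).
Qed.

Lemma resolution_map_comp i A B C (f : {linear B -> C}) (g : {linear A -> B})
    (h : {linear A -> C}) :
  (forall x, h x = f (g x)) ->
  forall z, resolution_map h i z = resolution_map f i (resolution_map g i z).
Proof. by move=> hE z; apply: free_map_comp; exact: syzygy_map_comp. Qed.

Lemma free_map_id A (f : A -> A) : f =1 id -> free_map f =1 id.
Proof.
move=> fE; apply: (@freeg_ext _ _ _ (free_map f) idfun) => x.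
by rewrite /= liftU scale1r fE.
Qed.

Lemma resolution_map_id i A (f : {linear A -> A}) :
  f =1 id -> resolution_map f i =1 id.
Proof.
move=> fE; apply: free_map_id; elim: i => [|i IHi] //= z.
by apply: val_inj => /=; rewrite free_map_id.
Qed.

(** Cocycles and coboundaries are predicates on bare functions, so that they apply to composites and
    sums without repackaging these as elements of [hom]. *)
Definition cocycle A X i (f : resolution A i -> X) : Prop :=
  forall z, f (resolution_d A i z) = 0.

Definition coboundary A X i : (resolution A i -> X) -> Prop :=
  match i with
  | 0 => fun f => forall z, f z = 0
  | j.+1 => fun f => exists g : {linear resolution A j -> X},
                       forall z, f z = g (resolution_d A j z)
  end.

Lemma coboundary_pull i A B X (u : {linear A -> B}) (f : resolution B i -> X)
    (f' : resolution A i -> X) :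
  (forall z, f' z = f (resolution_map u i z)) -> coboundary f -> coboundary f'.
Proof.
case: i f f' => [|i] f f' fE /=; first by move=> f0 z; rewrite fE.
case=> g gE; exists (g \o resolution_map u i) => z.
by rewrite fE gE /= resolution_map_d.
Qed.

Lemma resolution_exact A i z : resolution_d A i z = 0 ->
  exists y, z = resolution_d A i.+1 y.
Proof.
move=> dz; have zK : z \in lin_ker (free_eval (syzygy A i.+1)).
  by apply/mem_set; apply: val_inj; exact: dz.
have [y yE] := free_eval_surj (in_submodule zK).
by exists y; rewrite /resolution_d [_ y]/= yE.
Qed.

(** A cocycle factors through a map [g] on [syzygy B i.+1]. Since [syzygy_map u i] factors through a
    free module, [syzygy_map u i.+1] extends to a map [k] on [resolution A i], and [g \o k] is the
    required cochain. *)
Lemma null_coboundary i A B X (u : {linear A -> B})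
    (f : {linear resolution B i.+1 -> X}) :
  null i u -> cocycle f -> coboundary (f \o resolution_map u i.+1).
Proof.
move=> nu fc.
have {nu} [h hE] := @null_syzygy_map _ 0 i _ _ u nu.
have [|k kE] := corestrict (L := lin_ker (free_eval (syzygy B i)))
    (f := resolution_map u i \- (h \o free_eval (syzygy A i))).
  by move=> z; apply/mem_set; rewrite /= linearB /= free_mapE -hE subrr.
have [g gE] : exists g : {linear syzygy B i.+1 -> X},
    forall z, f z = g (free_eval (syzygy B i.+1) z).
  have [|||g gE] := @linear_of_rel _ (syzygy B i.+1) X
      (fun x y => forall z, free_eval (syzygy B i.+1) z = x -> f z = y).
  - move=> x; have [z zE] := free_eval_surj x; exists (f z) => w wE.
    apply/eqP; rewrite -subr_eq0 -linearB; apply/eqP.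
    have [|y ->] := @resolution_exact B i (w - z); last exact: fc.
    by rewrite /resolution_d [_ (w - z)]/= linearB wE zE subrr.
  - move=> r x y x' y' H H' z zE.
    have [w wE] := free_eval_surj x.
    rewrite -(H w wE) -(H' (z - r *: w)).
      by rewrite -linearP addrC subrK.
    by rewrite linearB linearZ /= wE zE addrAC subrr add0r.
  - by move=> y /(_ 0); rewrite !linear0 => ->.
  by exists g => z; exact: gE.
exists (g \o k) => z.
rewrite /= gE; congr (g _); apply: val_inj.
apply: esym; apply: etrans (kE _) _; rewrite /resolution_d /= free_mapE.
by have /set_mem /= -> := valP (free_eval (syzygy A i.+1) z); rewrite linear0 subr0.
Qed.

End ResolutionMaps.

(** * Vanishing of local cohomology in terms of cochains *)

Section LocalCohomology.
Variables (R : comNzRingType) (a : submodClosed R^o).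
Implicit Types X Y L Q : lmodType R.

Definition quot_proj (M : lmodType R) (I J : submodClosed M)
    (IJ : forall x, x \in I -> x \in J) : {linear quotmod I -> quotmod J} :=
  quot_map (f := idfun) IJ.

Lemma quot_projE (M : lmodType R) (I J : submodClosed M)
    (IJ : forall x, x \in I -> x \in J) x :
  quot_proj IJ (\pi_(quotmod I) x) = \pi_(quotmod J) x.
Proof. exact: quot_map_pi. Qed.

Lemma ideal_pow_sub n m : (n <= m)%N ->
  forall x, x \in ideal_pow a m -> x \in ideal_pow a n.
Proof.
move=> /subnK <-; elim: (m - n)%N => // k IHk x; rewrite addSn => /ideal_powS.
exact: IHk.
Qed.

Definition pow_proj n m (nm : (n <= m)%N) := quot_proj (ideal_pow_sub nm).

Lemma pow_proj_comp n m k (nm : (n <= m)%N) (mk : (m <= k)%N) (nk : (n <= k)%N) x :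
  pow_proj nk x = pow_proj nm (pow_proj mk x).
Proof.
by rewrite -[x]reprK /pow_proj (quot_projE (ideal_pow_sub nk))
  (quot_projE (ideal_pow_sub mk)) (quot_projE (ideal_pow_sub nm)).
Qed.

(** The vanishing of H^i_a(X) unfolded to representatives: a class dies in the direct limit when its
    pullback to some higher power of [a] is a coboundary. [hvanishP] links it to
    [local_cohomology]. *)
Definition hvanish i X : Prop :=
  forall n (f : {linear resolution (quotmod (ideal_pow a n)) i -> X}),
  cocycle f -> exists (m : nat) (nm : (n <= m)%N),
    coboundary (f \o resolution_map (pow_proj nm) i).

Local Notation cpx n X := (hom_complex (quotmod (ideal_pow a n)) X).

Lemma cocyclesP n X i (z : submodule (cocycles (cpx n X) i)) :
  cocycle (val (val z : Defs.hom _ _)).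
Proof.
move=> w.
exact: (congr1 (fun h : Defs.hom _ _ => val h w) (set_mem (valP z))).
Qed.

Lemma coboundariesP n X i (h : cpx n X i) :
  h \in coboundaries (cpx n X) i <-> coboundary (val (h : Defs.hom _ _)).
Proof.
case: i h => [|i] h; split.
- by move=> /set_mem /= -> w.
- by move=> h0; apply/mem_set; apply: val_inj; apply/funext.
- by move=> /set_mem /= [g _ <-]; exists (hom_fun g).
case=> g gE; apply/mem_set.
have lg : (g : _ -> _) \in
    submod_of (hom_subproof (resolution (quotmod (ideal_pow a n)) i) X).
  by apply/mem_set => r x y; exact: linearP.
exists (in_submodule lg) => //; apply: val_inj; apply/funext => w.
by rewrite gE.
Qed.

Lemma class_eq0 n X i (z : submodule (cocycles (cpx n X) i)) :
  \pi_(cohomology (cpx n X) i) z = 0 <-> coboundary (val (val z : Defs.hom _ _)).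
Proof.
rewrite -(pi_quot0 (submod_trace (cocycles (cpx n X) i) (coboundaries (cpx n X) i))).
split=> [/eqP|/coboundariesP zB].
  by rewrite eq_quotmod subr0 => /set_mem /coboundariesP.
by apply/eqP; rewrite eq_quotmod subr0; apply/mem_set.
Qed.

(** The standard resolution is functorial, so pulling back along the successive projections amounts
    to pulling back along [pow_proj nm]; this makes the transition maps visible on cocycles. *)
Lemma push_rep n X i (z : submodule (cocycles (cpx n X) i)) m (nm : (n <= m)%N) :
  exists z' : submodule (cocycles (cpx m X) i),
    dirlim_push (fun n => ext_map X (quot_pow_proj a n) i)
      (\pi_(cohomology (cpx n X) i) z) m = \pi_(cohomology (cpx m X) i) z' /\
    forall w, val (val z' : Defs.hom _ _) w
              = val (val z : Defs.hom _ _) (resolution_map (pow_proj nm) i w).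
Proof.
elim: m nm => [|m IHm] nm.
  have e : n = 0%N by apply/eqP; rewrite -leqn0.
  subst n.
  exists z; split; first exact: (@push_id _ (fun n => ext _ X i)
    (fun n => ext_map X (quot_pow_proj a n) i)).
  move=> w; rewrite resolution_map_id // => x.
  by rewrite -[x]reprK /pow_proj quot_projE.
case: (ltnP m n) => [mn|nm'].
  have e : n = m.+1 by apply/anti_leq; rewrite mn nm.
  subst n.
  exists z; split; first exact: (@push_id _ (fun n => ext _ X i)
    (fun n => ext_map X (quot_pow_proj a n) i)).
  move=> w; rewrite resolution_map_id // => x.
  by rewrite -[x]reprK /pow_proj quot_projE.
have [z' [pz' z'E]] := IHm nm'.
rewrite pushS // pz'.
exists (submod_map (@cmap_cocycles _ _ _ (hom_complex_map X (quot_pow_proj a m)) i) z').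
split; first exact: quot_map_pi.
move=> w; apply: etrans (z'E _) _; congr (val (val z : Defs.hom _ _) _).
by apply/esym/resolution_map_comp => x; exact: (pow_proj_comp nm' (leqnSn m)).
Qed.

Lemma local_class_eq0 n X i (z : submodule (cocycles (cpx n X) i)) :
  dirlim_in (fun n => ext_map X (quot_pow_proj a n) i)
      (\pi_(cohomology (cpx n X) i) z) = 0
  <-> exists (m : nat) (nm : (n <= m)%N),
    coboundary ((val (val z : Defs.hom _ _)) \o resolution_map (pow_proj nm) i).
Proof.
split=> [/dirlim_in0[m nm]|[m [nm cb]]].
  have [z' [-> z'E]] := push_rep z nm.
  move=> /class_eq0 z'0; exists m, nm.
  by move: z'0; congr coboundary; apply/funext => w; exact: z'E.
apply/dirlim_in0; exists m => //.
have [z' [-> z'E]] := push_rep z nm.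
by apply/class_eq0; move: cb; congr coboundary; apply/funext => w; exact: esym (z'E w).
Qed.

Lemma local_class_surj X i (x : local_cohomology a (Posz i) X) :
  exists n (z : submodule (cocycles (cpx n X) i)),
    dirlim_in (fun n => ext_map X (quot_pow_proj a n) i)
      (\pi_(cohomology (cpx n X) i) z) = x.
Proof.
have [n [y <-]] := dirlim_in_surj x.
by exists n, (repr y); rewrite reprK.
Qed.

Lemma hvanishP i X :
  hvanish i X <-> forall x : local_cohomology a (Posz i) X, x = 0.
Proof.
split=> [hv x|H n f fc].
  have [n [z <-]] := local_class_surj x; apply/local_class_eq0.
  exact: (hv n (hom_fun (val z)) (@cocyclesP _ _ _ z)).
have lf : (f : _ -> _) \in
    submod_of (hom_subproof (resolution (quotmod (ideal_pow a n)) i) X).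
  by apply/mem_set => r x y; exact: linearP.
have zc : (in_submodule lf : cpx n X i) \in cocycles (cpx n X) i.
  by apply/mem_set; apply: val_inj; apply/funext => w; exact: fc.
exact: (local_class_eq0 (in_submodule zc)).1 (H _).
Qed.

End LocalCohomology.

(** * Vanishing of local cohomology in short exact sequences *)

Section VanishingExact.
Variables (R : comNzRingType) (a : submodClosed R^o).
Implicit Types A B X Y L Q : lmodType R.

Lemma resolution_projective A i : projective (resolution A i).
Proof. exact: free_mod_projective. Qed.

Lemma coboundaryD A X i (f g : resolution A i -> X) :
  coboundary f -> coboundary g -> coboundary (fun z => f z + g z).
Proof.
case: i f g => [|i] f g /= => [f0 g0 z|[f' fE] [g' gE]].
  by rewrite f0 g0 addr0.
by exists (f' \+ g') => z; rewrite fE gE.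
Qed.

Lemma coboundary_post A X Y i (f : resolution A i -> X) (h : {linear X -> Y}) :
  coboundary f -> coboundary (h \o f).
Proof.
case: i f => [|i] f /= => [f0 z|[g gE]]; first by rewrite /= f0 linear0.
by exists (h \o g) => z; rewrite /= gE.
Qed.

Lemma coboundary_cocycle A X i (f : resolution A i -> X) :
  coboundary f -> cocycle f.
Proof.
case: i f => [|i] f /= => [f0 z|[g gE] z]; first by rewrite f0.
by rewrite gE -[RHS](linear0 g); congr (g _); exact: resolution_dd.
Qed.

Lemma coboundary_lift A X Q i (e : {linear X -> Q}) (f : resolution A i -> Q) :
  onto e -> coboundary f ->
  exists2 g : {linear resolution A i -> X}, coboundary g & forall z, e (g z) = f z.
Proof.
move=> se; case: i f => [|i] f /=.
  by move=> f0; exists \0 => // z; rewrite f0 linear0.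
case=> g gE; have [h hE] := resolution_projective se g.
by exists (h \o resolution_d A i); [exists h | move=> z; rewrite /= hE gE].
Qed.

Lemma coboundary_ext A X i (f g : resolution A i -> X) :
  f =1 g -> coboundary f -> coboundary g.
Proof. by move=> /funext ->. Qed.

(** The image of a cocycle in [Q] becomes a coboundary, which lifts to a coboundary [g] with values
    in [X]; subtracting [g] leaves a cocycle with values in [L]. *)
Lemma hvanish_ext i L X Q (j : {linear L -> X}) (e : {linear X -> Q}) :
  sexact j e -> hvanish a i L -> hvanish a i Q -> hvanish a i X.
Proof.
move=> se hL hQ n f fc.
have [|m [nm cb]] := hQ n (e \o f); first by move=> z; rewrite /= fc linear0.
have [g gb gE] := coboundary_lift (sexact_surj se) cb.
have [|h hE] := lift_ker (f := f \o resolution_map (pow_proj a nm) i \- g) se.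
  by move=> z; rewrite /= linearB /= gE subrr.
have [|k [mk cbk]] := hL m h.
  move=> z; apply: (sexact_inj se); rewrite hE /= resolution_map_d fc.
  by rewrite (coboundary_cocycle gb) subrr.
exists k, (leq_trans nm mk).
have gb' := coboundary_pull (u := pow_proj a mk) (fun=> erefl) gb.
apply: coboundary_ext (coboundaryD (coboundary_post j cbk) gb') => z /=.
rewrite hE /= subrK; congr (f _).
by apply: esym; apply: resolution_map_comp => x; exact: pow_proj_comp.
Qed.

(** The connecting map on cochains: a cocycle of [Q] lifts to a cochain [g] of [X] whose
    differential [h] lies in [L]. Once the pullback of [h] is the differential of [k], subtracting
    [j \o k] from the pullback of [g] gives a cocycle of [X]. *)
Lemma hvanish_quot i L X Q (j : {linear L -> X}) (e : {linear X -> Q}) :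
  sexact j e -> hvanish a i.+1 L -> hvanish a i X -> hvanish a i Q.
Proof.
move=> se hL hX n f fc.
have [g gE] := resolution_projective (sexact_surj se) f.
have [|h hE] := lift_ker (f := g \o resolution_d _ i) se.
  by move=> z; rewrite /= gE fc.
have [|m [nm [k kE]]] := hL n h.
  move=> z; apply: (sexact_inj se); rewrite hE /=.
  by rewrite -[RHS](linear0 g); congr (g _); exact: resolution_dd.
have [|l [ml cb]] := hX m (g \o resolution_map (pow_proj a nm) i \- (j \o k)).
  move=> z; rewrite /= resolution_map_d -[g _](hE _).
  by rewrite -[k _]kE subrr.
exists l, (leq_trans nm ml).
apply: coboundary_ext (coboundary_post e cb) => z /=.
rewrite linearB /= (sexact_im se) subr0 gE; congr (f _).
by apply: esym; apply: resolution_map_comp => x; exact: pow_proj_comp.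
Qed.

End VanishingExact.

(** * Powers of ideals and the bound on nonvanishing degrees *)

Section Ideals.
Variable R : comNzRingType.
Implicit Types (M : lmodType R) (I J : submodClosed R^o).

Lemma scale_regE (r x : R) : r *: (x : R^o) = r * x. Proof. by []. Qed.

Lemma gen_submod_min M (X : set M) (L : submodClosed M) :
  (forall x, X x -> x \in L) -> forall x, x \in gen_submod X -> x \in L.
Proof. by move=> XL x /set_mem /=; apply. Qed.

Lemma mem_gen_submod M (X : set M) x : X x -> x \in gen_submod X.
Proof. by move=> Xx; apply/mem_set => L; apply. Qed.

Lemma gen_submod_mono M (X Y : set M) : X `<=` Y ->
  forall x, x \in gen_submod X -> x \in gen_submod Y.
Proof. by move=> XY; apply: gen_submod_min => x /XY /mem_gen_submod. Qed.

Lemma gen_submod_nil M x : x \in gen_submod [set` ([::] : seq M)] -> x = 0.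
Proof.
move=> /gen_submod_min => /(_ (zero_submod M)) H.
by have /set_mem := H (fun y yn => False_ind _ (notF yn)).
Qed.

Fact adjoin_subproof M (L : submodClosed M) y :
  submod_set [set x | exists c : R, x - c *: y \in L].
Proof.
split=> [|r x x' [c cL] [c' cL']] /=.
  by exists 0; rewrite scale0r subr0 rpred0.
exists (r * c + c').
have -> : r *: x + x' - (r * c + c') *: y = r *: (x - c *: y) + (x' - c' *: y).
  by rewrite scalerBr scalerDl scalerA opprD addrACA.
by rewrite rpredD // rpredZ.
Qed.
(** This is L + Ry; membership is phrased through a coefficient of [y], which later constructions
    extract. *)
Definition adjoin M (L : submodClosed M) y := submod_of (adjoin_subproof L y).

Lemma adjoinP M (L : submodClosed M) y x :
  x \in adjoin L y <-> exists c : R, x - c *: y \in L.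
Proof. by split=> [/set_mem|/mem_set]. Qed.

Lemma sub_adjoin M (L : submodClosed M) y x : x \in L -> x \in adjoin L y.
Proof. by move=> xL; apply/adjoinP; exists 0; rewrite scale0r subr0. Qed.

Lemma mem_adjoin M (L : submodClosed M) y : y \in adjoin L y.
Proof. by apply/adjoinP; exists 1; rewrite scale1r subrr rpred0. Qed.

Lemma gen_submod_cons M (y : M) s x :
  x \in gen_submod [set` y :: s] <-> x \in adjoin (gen_submod [set` s]) y.
Proof.
split.
  apply: gen_submod_min => z zys; have /predU1P[->|zs] : z \in y :: s by exact: zys.
    exact: mem_adjoin.
  exact/sub_adjoin/mem_gen_submod.
move=> /adjoinP[c xc]; rewrite -[x](subrK (c *: y)) rpredD //.
  by apply: gen_submod_mono xc => z /= zs; rewrite inE zs orbT.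
by apply/rpredZ/mem_gen_submod; rewrite /= mem_head.
Qed.

Fact colon_subproof M (L : submodClosed M) y :
  @submod_set R R^o [set r : R | r *: y \in L].
Proof.
split=> [|r x x' xL x'L] /=; first by rewrite scale0r rpred0.
by rewrite scalerDl rpredD // -[r *: x]/(r * x) -scalerA rpredZ.
Qed.
Definition colon M (L : submodClosed M) y := submod_of (colon_subproof L y).

Lemma colonE M (L : submodClosed M) y r : (r \in colon L y) = (r *: y \in L).
Proof. by apply/idP/idP => [/set_mem|/mem_set]. Qed.

Lemma ideal_mulr I r z : z \in I -> r * z \in I.
Proof. exact: rpredZ. Qed.

Lemma mem_ideal_mul I J r s : r \in I -> s \in J -> r * s \in ideal_mul I J.
Proof. by move=> rI sJ; apply: mem_gen_submod; exists r => //; exists s. Qed.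

Lemma ideal_pow_mono I J n : (forall x, x \in I -> x \in J) ->
  forall x, x \in ideal_pow I n -> x \in ideal_pow J n.
Proof.
move=> IJ; elim: n => [|n IHn] // x; apply: gen_submod_min => _ [r rI [s sI <-]].
by apply: mem_ideal_mul; [exact: IJ | exact: IHn].
Qed.

Lemma ideal_pow0 I x : x \in ideal_pow I 0.
Proof. exact/mem_set. Qed.

Lemma mem_ideal_exp I x n : x \in I -> x ^+ n \in ideal_pow I n.
Proof.
move=> xI; elim: n => [|n IHn]; first exact: ideal_pow0.
by rewrite exprS; apply: mem_ideal_mul.
Qed.

(** Induction on [k + l]: in a product r w with r = r' + c x and r' in [b], the summand r' w lowers
    [k] and the summand c x w lowers [l]. *)
Lemma ideal_pow_adjoin_sub (b : submodClosed R^o) (x : R^o) k l z :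
  z \in ideal_pow (adjoin b x) (k + l) ->
  z \in adjoin (ideal_pow b k) (x ^+ l : R^o).
Proof.
move En : (k + l)%N => n; elim: n k l En z => [|n IHn] k l kl z.
  by case: k l kl => [|//] [|//] _ _; apply/sub_adjoin/ideal_pow0.
apply: gen_submod_min => _ [r rI [w wI <-]].
have /adjoinP[c rc] : r \in adjoin b x by exact: rI.
rewrite -[r](subrK (c *: x)) mulrDl rpredD //.
  case: k kl => [|k] kl; first exact/sub_adjoin/ideal_pow0.
  have /adjoinP[d wd] := IHn k l (succn_inj kl) w wI.
  rewrite -[w](subrK (d *: (x ^+ l : R^o))) mulrDr rpredD //.
    by apply/sub_adjoin/mem_ideal_mul.
  rewrite ?scale_regE mulrA; apply: ideal_mulr; exact: mem_adjoin.
case: l kl => [|l] kl.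
  by apply/adjoinP; exists (c *: x * w); rewrite ?scale_regE mulr1 subrr rpred0.
rewrite addnS in kl; have /adjoinP[d wd] := IHn k l (succn_inj kl) w wI.
apply/adjoinP; exists (c * d).
have -> : c *: x * w - c * d *: (x ^+ l.+1 : R^o)
    = (c * x) * (w - d *: (x ^+ l : R^o)).
  by rewrite ?scale_regE mulrBr exprS; congr (_ - _); rewrite -!mulrA; congr (_ * _);
     rewrite mulrCA.
exact: ideal_mulr.
Qed.

Lemma adjoin_pow_sub (b : submodClosed R^o) (x : R^o) n z :
  z \in adjoin (ideal_pow b n) (x ^+ n : R^o) -> z \in ideal_pow (adjoin b x) n.
Proof.
move=> /adjoinP[c zc]; rewrite -[z](subrK (c *: (x ^+ n : R^o))) rpredD //.
  by apply: ideal_pow_mono zc => y; exact: sub_adjoin.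
by apply/rpredZ/mem_ideal_exp/mem_adjoin.
Qed.

Lemma uniform_bound (T : eqType) (P : T -> nat -> Prop) (s : seq T) :
  (forall x k l, (k <= l)%N -> P x k -> P x l) ->
  (forall x, x \in s -> exists k, P x k) ->
  exists k, forall x, x \in s -> P x k.
Proof.
move=> Pm; elim: s => [|y s IHs] H; first by exists 0%N.
have [k kP] := H y (mem_head _ _).
have [|l lP] := IHs; first by move=> x xs; apply: H; rewrite inE xs orbT.
exists (maxn k l) => x; rewrite inE => /predU1P[->|xs].
  exact: Pm (leq_maxl _ _) kP.
by apply: Pm (leq_maxr _ _) _; exact: lP.
Qed.

(** The ideals (I : x^k) increase with k, and finitely many generators of their union are caught by
    one exponent. *)
Lemma saturation_bound (noeth : noetherian R) (I : submodClosed R^o) (x : R) :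
  exists e, forall k z, x ^+ k * z \in I -> x ^+ e * z \in I.
Proof.
have sub : @submod_set R R^o [set z : R | exists k, x ^+ k * z \in I].
  split=> [|r y z [k yk] [l zl]]; first by exists 0%N; rewrite mulr0; exact: (rpred0 I).
  exists (k + l)%N.
  have -> : x ^+ (k + l) * ((r *: y : R^o) + z) =
      (r * x ^+ l) * (x ^+ k * y) + x ^+ k * (x ^+ l * z).
    by rewrite scale_regE exprD; ring.
  by apply: (@rpredD _ I); exact: ideal_mulr.
have [s sE] := noeth (submod_of sub).
have up z k l : (k <= l)%N -> x ^+ k * z \in I -> x ^+ l * z \in I.
  by move=> /subnK <-; rewrite exprD -mulrA; exact: ideal_mulr.
have [e eP] : exists e, forall z, z \in s -> x ^+ e * z \in I.
  apply: (@uniform_bound R^o (fun z k => x ^+ k * z \in I) s) => [z k l|z zs].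
    exact: up.
  have : [set` submod_of sub] z by rewrite sE; exact: mem_gen_submod.
  by move=> /set_mem.
exists e => k z zk.
have : [set` submod_of sub] z by apply/mem_set; exists k.
rewrite sE /=; have esub : @submod_set R R^o [set z : R | x ^+ e * z \in I].
  split=> [|r y w ye we] /=; first by rewrite mulr0; exact: (rpred0 I).
  rewrite ?scale_regE mulrDr; apply: (@rpredD _ I) => //.
  by rewrite mulrCA; apply: ideal_mulr.
move=> zs; suff /set_mem : z \in submod_of esub by [].
by apply: gen_submod_min zs => y ys; apply/mem_set/eP.
Qed.

Lemma regular_projective : projective R^o.
Proof.
move=> X Q e se f; have [x xE] := se (f 1).
have [g gE] : exists g : {linear R^o -> X}, forall r : R, g r = r *: x.
  apply: (@linear_of_rel _ R^o X (fun r y => y = r *: x))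
    => [r|r y w y' w' -> ->|y ->].
  - by eexists.
  - by rewrite scalerDl scalerA.
  - by rewrite scale0r.
exists g => r; rewrite gE linearZ /= xE -linearZ; congr (f _).
exact: mulr1.
Qed.

Lemma mul_quot I J (y : R) : (forall z, z \in I -> y * z \in J) ->
  exists h : {linear quotmod I -> quotmod J},
    forall z : R^o, h (\pi_(quotmod I) z) = \pi_(quotmod J) (y * z : R^o).
Proof.
move=> IJ; have [f fE] : exists f : {linear R^o -> R^o}, forall z, f z = y * z.
  apply: (@linear_of_rel _ R^o R^o (fun z w => w = y * z))
    => [r|r z w z' w' -> ->|w ->].
  - by eexists.
  - by rewrite mulrDr /GRing.scale /= mulrCA.
  - by rewrite mulr0.
have fIJ z : z \in I -> f z \in J by rewrite fE; exact: IJ.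
by exists (quot_map fIJ) => z; apply: etrans (quot_map_pi fIJ z) _; rewrite fE.
Qed.

Lemma pi_quot_eq0 M (L : submodClosed M) x :
  \pi_(quotmod L) x = 0 <-> x \in L.
Proof.
rewrite -(pi_quot0 L); split=> [/eqP|xL]; first by rewrite eq_quotmod subr0.
by apply/eqP; rewrite eq_quotmod subr0.
Qed.

Lemma pi_quot_surj M (L : submodClosed M) (q : quotmod L) :
  exists x, \pi_(quotmod L) x = q.
Proof. by exists (repr q); rewrite reprK. Qed.

Lemma sexact_colon I (y : R^o) (IJ : forall x, x \in I -> x \in adjoin I y) :
  exists2 j : {linear quotmod (colon I y) -> quotmod I},
    forall z : R^o, j (\pi_(quotmod (colon I y)) z) = \pi_(quotmod I) (y * z : R^o)
    & sexact j (quot_proj IJ).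
Proof.
have [|j jE] := @mul_quot (colon I y) I y.
  by move=> z; rewrite colonE mulrC.
exists j => //; split=> [q|q|q|q].
- have [z <-] := pi_quot_surj q; rewrite jE => /pi_quot_eq0 yz.
  by apply/pi_quot_eq0; rewrite colonE; rewrite mulrC in yz.
- have [z <-] := pi_quot_surj q; rewrite quot_projE => /pi_quot_eq0 /adjoinP[c zc].
  exists (\pi_(quotmod (colon I y)) (c : R^o)); rewrite jE; apply/eqP.
  rewrite eq_quotmod -opprB -scaleN1r rpredZ //.
  by rewrite -[y * c]/(y *: (c : R^o)) [_ *: _]mulrC.
- have [z <-] := pi_quot_surj q; rewrite jE quot_projE; apply/pi_quot_eq0.
  by rewrite mulrC; apply: ideal_mulr; exact: mem_adjoin.
- have [z <-] := pi_quot_surj q; exists (\pi_(quotmod I) z).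
  exact: quot_projE.
Qed.

(** Each generator costs one more degree: [null_ladder] is applied to the sequences of
    [sexact_colon] at the exponents [k], [m] and [n]. *)
Lemma pow_null (noeth : noetherian R) (s : seq R^o) n :
  exists (m : nat) (nm : (n <= m)%N),
    null (size s) (pow_proj (gen_submod [set` s]) nm).
Proof.
elim: s n => [|x s IHs] n.
  (* Without generators b^(n+1) is zero, whereas b^0 is the whole ring; hence R/b^(n+1) is R and the
     projection factors through a free module. *)
  exists n.+1, (leqnSn n); set b := gen_submod _.
  have [v vE] : exists v : {linear quotmod (ideal_pow b n.+1) -> R^o},
      forall q, q = \pi_(quotmod (ideal_pow b n.+1)) (v q).
    apply: (@linear_of_rel _ _ R^o (fun q z => q = \pi_(quotmod (ideal_pow b n.+1)) z))
      => [q|r y z y' z' -> ->|z].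
    - by exists (repr q); rewrite reprK.
    - by rewrite pi_quot_linear.
    - move=> /esym /pi_quot_eq0 zb.
      have /set_mem : z \in zero_submod R^o; last by [].
      apply: gen_submod_min zb => _ [r /gen_submod_nil -> [w _ <-]].
      by apply/mem_set; rewrite /= mul0r.
  have [p pE] : exists p : {linear R^o -> quotmod (ideal_pow b n)},
      forall z, p z = \pi_(quotmod (ideal_pow b n)) z.
    apply: (@linear_of_rel _ R^o _ (fun z q => q = \pi_(quotmod (ideal_pow b n)) z))
      => [z|r y z y' z' -> ->|z ->].
    - by eexists.
    - by rewrite pi_quot_linear.
    - exact: pi_quot0.
  apply: (@factors_projective _ R^o _ _ _ p v regular_projective) => q.
  by rewrite pE {1}[q]vE /pow_proj quot_projE.
set b := gen_submod [set` s] in IHs; set a := gen_submod _.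
have aE z : z \in a <-> z \in adjoin b x by exact: gen_submod_cons.
have [m [nm nul]] := IHs n; have [m' [mm' nul']] := IHs m.
have [e eP] := saturation_bound noeth (ideal_pow b m') x.
(* If x^k z lies in b^k, hence in b^m', then x^e z lies in b^m' by the choice of [e]. As e <= k - m,
   multiplication by x^(k - m) maps R/(b^k : x^k) to R/b^m', and the projection from there to R/b^m
   is null. *)
pose k := (m' + m + e)%N.
have m'k : (m' <= k)%N by rewrite /k -addnA leq_addr.
have mk : (m <= k)%N by exact: leq_trans mm' m'k.
have nk : (n <= k)%N by exact: leq_trans nm mk.
have sub l : forall z, z \in ideal_pow b l -> z \in adjoin (ideal_pow b l) (x ^+ l : R^o).
  by move=> z; exact: sub_adjoin.
have W l l' : (l <= l')%N -> forall z, z \in adjoin (ideal_pow b l') (x ^+ l' : R^o) ->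
    z \in adjoin (ideal_pow b l) (x ^+ l : R^o).
  move=> ll z /adjoinP[c zc]; apply/adjoinP; exists (c * x ^+ (l' - l)).
  rewrite -[_ *: _]mulrA -exprD subnK //; exact: ideal_pow_sub zc.
have [j1 j1E s1] := sexact_colon (sub k).
have [j2 j2E s2] := sexact_colon (sub m).
have [j3 j3E s3] := sexact_colon (sub n).
have [|a1 a1E] := @mul_quot (colon (ideal_pow b k) (x ^+ k : R^o))
    (ideal_pow b m') (x ^+ (k - m)).
  move=> z; rewrite colonE scale_regE mulrC => /(ideal_pow_sub m'k) /eP.
  have /subnK <- : (e <= k - m)%N by rewrite leq_subRL // addnC /k addnC -addnA leq_addl.
  by rewrite exprD -mulrA; exact: ideal_mulr.
have subc : forall z, z \in ideal_pow b m -> z \in colon (ideal_pow b m) (x ^+ m : R^o).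
  by move=> z zb; rewrite colonE scale_regE mulrC; exact: ideal_mulr.
have na1 := null_comp (w := quot_proj subc \o pow_proj b mm' \o a1) (fun=> erefl) nul'.
have := null_ladder (b1 := pow_proj b mk) (c1 := quot_proj (W _ _ mk))
  (c2 := quot_proj (W _ _ nm)) s1 s2 s3 _ _ _ na1 (nullS nul).
move=> H; have {H} nW : null (size s).+1 (quot_proj (W n m nm) \o quot_proj (W m k mk)).
  apply: H => q; have [z <-] := pi_quot_surj q.
  - transitivity (j2 (quot_proj subc (pow_proj b mm' (a1 (\pi_(quotmod _) z))))) => //.
    rewrite j1E a1E /pow_proj !quot_projE j2E.
    by rewrite mulrA -exprD subnKC.
  - by rewrite /pow_proj !quot_projE.
  - by rewrite /pow_proj !quot_projE.
have n2k : (n <= k + k)%N by exact: leq_trans nk (leq_addr _ _).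
(* The power a^(k + k) lies in b^k + (x^k), and b^n + (x^n) lies in a^n, so the projection for [a]
   factors through the null map of [nW]. *)
exists (k + k)%N, n2k.
have aW z : z \in ideal_pow a (k + k) -> z \in adjoin (ideal_pow b k) (x ^+ k : R^o).
  by move=> za; apply: ideal_pow_adjoin_sub; apply: ideal_pow_mono za => y /aE.
have Wa z : z \in adjoin (ideal_pow b n) (x ^+ n : R^o) -> z \in ideal_pow a n.
  by move=> /adjoin_pow_sub; apply: ideal_pow_mono => y /aE.
apply: (null_comp (a := quot_proj aW) (b := quot_proj Wa) _ nW) => q.
have [z <-] := pi_quot_surj q.
transitivity (quot_proj Wa (quot_proj (W n m nm) (quot_proj (W m k mk)
  (quot_proj aW (\pi_(quotmod _) z))))) => //.
by rewrite /pow_proj !quot_projE.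
Qed.

Lemma null_leq (A B : lmodType R) i k (u : {linear A -> B}) :
  (i <= k)%N -> null i u -> null k u.
Proof. by move=> /subnK <- nu; elim: (k - i)%N => // l; exact: nullS. Qed.

(** A map that is [null (size s)] kills Ext from degree [(size s).+1] on, which is why the bound
    exceeds the number of generators by one. *)
Lemma hvanish_bound (noeth : noetherian R) (a : submodClosed R^o) :
  exists c, forall i (X : lmodType R), (c <= i)%N -> hvanish a i X.
Proof.
have [s sE] := noeth a; have -> : a = gen_submod [set` s] by exact: submod_inj.
exists (size s).+1 => -[|i] X // ci n f fc.
have [m [nm nul]] := pow_null noeth s n; exists m, nm.
apply: (null_coboundary _ fc); apply: null_leq nul; exact: ci.
Qed.

End Ideals.

(** * Cohomological dimension as a threshold for vanishing *)

Section CohomologicalDimension.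
Variables (R : comNzRingType) (a : submodClosed R^o) (X : lmodType R).
Import Order.TTheory Num.Theory.

Let degrees : set (\bar int) := [set i%:E%E | i in [set i : int |
  0 <= i /\ exists x : local_cohomology a i X, x != 0]].

Let degreesP (e : \bar int) :
  degrees e <-> exists2 i : nat, e = (Posz i)%:E%E & ~ hvanish a i X.
Proof.
split=> [[[i|i] [// _ [x x0]] <-]|[i -> hi]].
  by exists i => // /hvanishP /(_ x) xE; rewrite xE eqxx in x0.
exists (Posz i) => //; split=> //; apply: contrapT => H; apply/hi/hvanishP => x.
by apply/eqP/negPn/negP => x0; apply: H; exists x.
Qed.

Let degrees_sup : degrees !=set0 -> supremums degrees !=set0.
Proof.
move=> [e0 /degreesP[i0 _ hi0]].
(* A nonempty bounded set of degrees has a maximum; an unbounded one has supremum [+oo]. *)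
have [[M HM]|H] := pselect (exists M : nat, forall i, ~ hvanish a i X -> (i <= M)%N).
  have [||m /asboolP hm mM] := @ex_maxnP (fun i => `[< ~ hvanish a i X >]) M.
  - by exists i0; apply/asboolP.
  - by move=> i /asboolP /HM.
  exists (Posz m)%:E%E; split=> [e /degreesP[i -> hi]|e]; last first.
    by apply; apply/degreesP; exists m.
  by rewrite lee_fin lez_nat mM //; apply/asboolP.
exists +oo%E; split=> [e _|[r||] ub]; rewrite ?leey //; exfalso.
  apply: H; exists `|r|%N => i hi.
  have : ((Posz i)%:E <= r%:E)%E by apply: ub; apply/degreesP; exists i.
  rewrite lee_fin => ir; rewrite -lez_nat (le_trans ir) //.
  by rewrite abszE ler_norm.
have : ((Posz i0)%:E <= -oo :> \bar int)%E by apply: ub; apply/degreesP; exists i0.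
by rewrite leeNy_eq.
Qed.

Lemma cohom_dim_lt (t : int) :
  (cohom_dim a X < t%:E)%E <-> forall i : nat, t <= Posz i -> hvanish a i X.
Proof.
rewrite /cohom_dim -/degrees; split=> [ct i ti|H].
  apply: contrapT => hi; have di : degrees (Posz i)%:E%E by apply/degreesP; exists i.
  have := ge_supremum_Nmem -oo%E (degrees_sup (ex_intro _ _ di)) di.
  move=> /le_lt_trans /(_ ct); rewrite lte_fin ltNge ti //.
rewrite /supremum; case: ifP => _; first exact: ltNyr.
case: xgetP => [e -> [_ lub]|_]; last exact: ltNyr.
(* Degrees are integers, so being below [t] is the weak bound [t - 1], which passes to the
   supremum. *)
apply: (@le_lt_trans _ _ (t - 1)%:E%E); last by rewrite lte_fin ltrBlDr ltrDl.
apply: lub => _ /degreesP[i -> hi]; rewrite lee_fin.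
rewrite -ltzD1 subrK ltNge; apply/negP => ti; exact/hi/H.
Qed.

End CohomologicalDimension.

(** * Noetherian induction and finitely generated submodules *)

Section Noetherian.
Variables (R : comNzRingType) (noeth : noetherian R).

(** A counterexample would start a strictly increasing chain of counterexamples; the union of the
    chain is finitely generated, so some member already contains it. *)
Lemma noetherian_ind (P : submodClosed R^o -> Prop) :
  (forall I : submodClosed R^o, (forall J : submodClosed R^o,
     (forall x, x \in I -> x \in J) ->
     (exists2 x, x \in J & x \notin I) -> P J) -> P I) -> forall I, P I.
Proof.
move=> H I0; apply: contrapT => nI0.
pose T := {I : submodClosed R^o | ~ P I}.
have /choice[f fP] : forall I : T, exists J : T,
    (forall x, x \in proj1_sig I -> x \in proj1_sig J) /\
    (exists2 x, x \in proj1_sig J & x \notin proj1_sig I).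
  move=> [I nI]; apply: contrapT => HJ; apply/nI/H => J IJ xJ.
  by apply: contrapT => nJ; apply: HJ; exists (exist _ J nJ).
pose c k := proj1_sig (iter k f (exist _ I0 nI0)).
have cS k x : x \in c k -> x \in c k.+1 by apply: (fP _).1.
have cle k l x : (k <= l)%N -> x \in c k -> x \in c l.
  by move=> /subnK <-; elim: (l - k)%N => // n IHn /IHn; exact: cS.
have sub : @submod_set R R^o [set x : R^o | exists k, x \in c k].
  split=> [|r x y [k xk] [l yl]]; first by exists 0%N; exact: rpred0.
  exists (maxn k l); rewrite rpredD ?rpredZ //.
    by apply: cle xk; exact: leq_maxl.
  by apply: cle yl; exact: leq_maxr.
have [s sE] := noeth (submod_of sub).
have [k kP] : exists k, forall x, x \in s -> x \in c k.
  apply: (@uniform_bound R^o (fun x k => x \in c k)) => [x k l|x xs].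
    exact: cle.
  have : [set` submod_of sub] x by rewrite sE; exact: mem_gen_submod.
  by move=> /set_mem.
have [x xk /negP] := (fP (iter k f (exist _ I0 nI0))).2; apply.
have : [set` submod_of sub] x by apply/mem_set; exists k.+1.
by rewrite sE; apply: gen_submod_min.
Qed.

(** Induction on the generators: the coefficients of [y] in elements of [L] form an ideal, generated
    by some [rs]. Lifts [w] of these to [L], together with generators of the intersection of [L]
    with the span of the remaining generators, generate [L]. *)
Lemma noetherian_sub (M : lmodType R) (s : seq M) (L : submodClosed M) :
  (forall x, x \in L -> x \in gen_submod [set` s]) -> fin_gen [set` L].
Proof.
elim: s L => [|y s IHs] L Ls.
  exists [::]; apply/seteqP; split=> x /= xL; first exact: Ls.
  by rewrite (gen_submod_nil xL) rpred0.
have subI : @submod_set R R^o [set r : R | exists2 x, x \in L & x - r *: y \in gen_submod [set` s]].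
  split=> [|r u v [x xL xu] [x' x'L x'v]].
    by exists 0; rewrite ?rpred0 // scale0r subr0 rpred0.
  exists (r *: x + x'); first by rewrite rpredD ?rpredZ.
  have -> : r *: x + x' - ((r *: u : R^o) + v) *: y = r *: (x - u *: y) + (x' - v *: y).
    by rewrite scale_regE scalerBr scalerDl scalerA opprD addrACA.
  by rewrite rpredD ?rpredZ.
have subL' : submod_set [set x | x \in L /\ x \in gen_submod [set` s]].
  split=> [|r u v [uL us] [vL vs]]; first by split; exact: rpred0.
  by split; rewrite rpredD ?rpredZ.
have [|s' s'E] := IHs (submod_of subL'); first by move=> x /set_mem[].
have [rs rsE] := noeth (submod_of subI).
have /choice[w wP] : forall r : R^o, exists x : M, r \in rs ->
    x \in L /\ x - r *: y \in gen_submod [set` s].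
  move=> r; have [rrs|_] := boolP (r \in rs); last by exists 0.
  have : [set` submod_of subI] r by rewrite rsE; exact: mem_gen_submod.
  by move=> /set_mem[x xL xr]; exists x.
have s'L x : x \in gen_submod [set` s'] -> x \in L /\ x \in gen_submod [set` s].
  move=> xs'; have : [set` submod_of subL'] x by rewrite s'E.
  by move=> /set_mem.
have wL x : x \in gen_submod [set` map w rs] -> x \in L.
  by apply: gen_submod_min => _ /mapP[r rrs ->]; have [] := wP r rrs.
exists (s' ++ map w rs); apply/seteqP; split=> x.
  move=> xL; have xL' : x \in L by exact: xL.
  have /gen_submod_cons /adjoinP[c xc] := Ls x xL'.
  have sub : @submod_set R R^o [set c : R | exists2 z, z \in gen_submod [set` map w rs]
      & z - c *: y \in gen_submod [set` s]].
    split=> [|r u v [z zL zu] [z' z'L z'v]].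
      by exists 0; rewrite ?rpred0 // scale0r subr0 rpred0.
    exists (r *: z + z'); first by rewrite rpredD ?rpredZ.
    have -> : r *: z + z' - ((r *: u : R^o) + v) *: y = r *: (z - u *: y) + (z' - v *: y).
      by rewrite scale_regE scalerBr scalerDl scalerA opprD addrACA.
    by rewrite rpredD ?rpredZ.
  have cI : [set` submod_of subI] c by apply/mem_set; exists x.
  rewrite rsE in cI; have /set_mem[z zw zc] : c \in submod_of sub.
    apply: gen_submod_min cI => r rrs; apply/mem_set; exists (w r).
      by apply: mem_gen_submod; apply: map_f.
    by have [] := wP r rrs.
  have xz : [set` submod_of subL'] (x - z).
    apply/mem_set; split.
      by rewrite rpredD // -scaleN1r rpredZ // wL.
    have -> : x - z = (x - c *: y) + (-1) *: (z - c *: y).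
      by rewrite scaleN1r opprB addrA subrK.
    by rewrite rpredD // rpredZ.
  rewrite s'E in xz; rewrite -[x](subrK z); apply: rpredD.
    by apply: gen_submod_mono xz => u us; rewrite /= mem_cat us.
  by apply: gen_submod_mono zw => u us; rewrite /= mem_cat us orbT.
apply: gen_submod_min => u; rewrite /= mem_cat => /orP[us|/mapP[r rrs ->]].
  by have [] := s'L u (mem_gen_submod us).
by have [] := wP r rrs.
Qed.

Lemma sexact_quotmod (M : lmodType R) (L : submodClosed M) :
  exists2 e : {linear M -> quotmod L}, forall x, e x = \pi_(quotmod L) x
    & sexact (\val : submodule L -> M) e.
Proof.
have [e eE] : exists e : {linear M -> quotmod L}, forall x, e x = \pi_(quotmod L) x.
  apply: (@linear_of_rel _ _ _ (fun x y => y = \pi_(quotmod L) x))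
    => [x|r x y x' y' -> ->|y ->].
  - by eexists.
  - by rewrite pi_quot_linear.
  - exact: pi_quot0.
exists e => //; split=> [x x0|x|x|q].
- exact: val_inj.
- by rewrite eE => /pi_quot_eq0 xL; exists (in_submodule xL).
- by rewrite eE; apply/pi_quot_eq0; exact: (valP x).
- by have [x <-] := pi_quot_surj q; exists x.
Qed.

(** * Devissage to quotients by prime ideals *)

Section Devissage.
Variable Phi : lmodType R -> Prop.
Hypothesis Phi0 : forall X : lmodType R, (forall x : X, x = 0) -> Phi X.
Hypothesis Phi_ext : forall (L X Q : lmodType R) (j : {linear L -> X}) (e : {linear X -> Q}),
  sexact j e -> Phi L -> Phi Q -> Phi X.
Variable C : submodClosed R^o.
Hypothesis PhiC : forall q : spec R, (forall r, r \in C -> r \in q) -> Phi (quotmod q).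

(** Noetherian induction replaces a prime filtration: if x y is in [I] with x and y outside, then
    R/I is an extension of R/(I + Rx) by R/(I : x), and both ideals are strictly larger than [I]. *)
Lemma devissage_cyclic (I : submodClosed R^o) :
  (forall r, r \in C -> r \in I) -> Phi (quotmod I).
Proof.
elim/noetherian_ind: I => I IHI CI.
have [I1|I1] := boolP ((1 : R^o) \in I).
  apply: Phi0 => q; have [x <-] := pi_quot_surj q; apply/pi_quot_eq0.
  by rewrite -[x]mulr1; apply: ideal_mulr.
have [[x [y [xy xI yI]]]|nI] := pselect (exists x y : R, [/\ x * y \in I, x \notin I & y \notin I]).
  have [j _ se] := sexact_colon (sub_adjoin (L := I) x).
  apply: (Phi_ext se); apply: IHI.
  - by move=> z zI; rewrite colonE scale_regE mulrC; exact: ideal_mulr.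
  - by exists y => //; rewrite colonE scale_regE mulrC.
  - by move=> r /CI rI; rewrite colonE scale_regE mulrC; exact: ideal_mulr.
  - by move=> z; exact: sub_adjoin.
  - by exists x => //; exact: mem_adjoin.
  - by move=> r /CI; exact: sub_adjoin.
have pI : forall x y : R, [set` I] (x * y) -> [set` I] x \/ [set` I] y.
  move=> x y xy; apply: contrapT => /not_orP[/negP xI /negP yI].
  by apply: nI; exists x, y.
pose q := Spec (submodP I) (negP I1) pI.
have <- : ideal_of_spec q = I by apply: submod_inj; rewrite submod_ofE.
by apply: PhiC => r /CI; exact: mem_set.
Qed.

(** Adding a generator [y] to [L] adds the quotient R/(L : y), and [C] lies in (L : y) because it
    kills [X]. *)
Lemma devissage_gen (X : lmodType R) (s : seq X) :
  (forall r (x : X), r \in C -> r *: x = 0) ->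
  Phi (submodule (gen_submod [set` s])).
Proof.
move=> CX; elim: s => [|y s IHs].
  apply: Phi0 => x; apply: val_inj; apply: gen_submod_nil; exact: (valP x).
set L := gen_submod [set` s] in IHs *; set L' := gen_submod _.
have L'P x : x \in L' <-> x \in adjoin L y by exact: gen_submod_cons.
have [|j jE] := corestrict (L := L') (f := (\val : submodule L -> X)).
  by move=> x; apply/L'P/sub_adjoin; exact: (valP x).
have [e eE] : exists e : {linear submodule L' -> quotmod (colon L y)},
    forall x, exists2 c : R^o, e x = \pi_(quotmod (colon L y)) c & val x - c *: y \in L.
  apply: (@linear_of_rel _ (submodule L') (quotmod (colon L y)) (fun x q =>
    exists2 c : R^o, q = \pi_(quotmod (colon L y)) c & val x - c *: y \in L)).
  - move=> x; have /L'P /adjoinP[c xc] := valP x.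
    by exists (\pi_(quotmod (colon L y)) (c : R^o)), c.
  - move=> r x q x' q' [c -> xc] [c' -> x'c']; exists (r *: c + c').
      by rewrite pi_quot_linear.
    have -> : val (r *: x + x') - ((r *: c : R^o) + c') *: y
        = r *: (val x - c *: y) + (val x' - c' *: y).
      by rewrite scale_regE scalerBr scalerDl scalerA opprD addrACA.
    by rewrite rpredD ?rpredZ.
  - move=> q [c -> ]; rewrite linear0 sub0r => cL; apply/pi_quot_eq0.
    by rewrite colonE -[_ *: _]opprK -scaleN1r rpredZ.
have eP (x : submodule L') (c : R^o) :
    val x - c *: y \in L -> e x = \pi_(quotmod (colon L y)) c.
  move=> xc; have [d -> xd] := eE x; apply/eqP; rewrite eq_quotmod colonE scalerBl.
  have -> : d *: y - c *: y = (val x - c *: y) + (-1) *: (val x - d *: y).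
    by rewrite scaleN1r opprB [RHS]addrC addrA subrK.
  by rewrite rpredD // rpredZ.
apply: (Phi_ext (j := j) (e := e)) => //.
  split=> [x x0|x ex|x|q].
  - by apply: val_inj; rewrite -(jE x) x0.
  - have [c ec xc] := eE x; move: ec; rewrite ex => /esym /pi_quot_eq0.
    rewrite colonE => cy; have xL : val x \in L.
      by rewrite -[val x](subrK (c *: y)) rpredD.
    by exists (in_submodule xL); apply: val_inj; rewrite jE.
  - rewrite (eP _ 0); first exact: pi_quot0.
    by rewrite scale0r subr0 jE; exact: (valP x).
  - have [c <-] := pi_quot_surj q.
    have cL : c *: y \in L' by apply/L'P; apply: rpredZ; exact: mem_adjoin.
    by exists (in_submodule cL); apply: eP; rewrite subrr; exact: rpred0.
apply: devissage_cyclic => r rC; rewrite colonE (CX _ _ rC); exact: rpred0.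
Qed.

Lemma devissage (X : lmodType R) : fin_gen [set: X] ->
  (forall r (x : X), r \in C -> r *: x = 0) -> Phi X.
Proof.
move=> [s sE] CX; have [e eE se] := sexact_quotmod (gen_submod [set` s]).
apply: (Phi_ext se (devissage_gen _ CX)); apply: Phi0 => q.
have [x <-] := pi_quot_surj q; apply/pi_quot_eq0.
by have : [set: X] x by []; rewrite sE.
Qed.

End Devissage.
End Noetherian.

(** * Vanishing at the primes containing the annihilator *)

Section Support.
Variables (R : comNzRingType) (noeth : noetherian R) (a : submodClosed R^o).
Implicit Types (X M : lmodType R) (q : spec R).

Lemma hvanish0 i X : (forall x : X, x = 0) -> hvanish a i X.
Proof.
move=> X0 n f _; exists n, (leqnn n).
by case: i f => [|i] f; [move=> z | exists \0 => z]; rewrite [LHS]X0.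
Qed.

Lemma hvanish_devissage i (C : submodClosed R^o) X :
  (forall q, (forall r, r \in C -> r \in (q : submodClosed _)) ->
     hvanish a i (quotmod q)) ->
  fin_gen [set: X] -> (forall r (x : X), r \in C -> r *: x = 0) ->
  hvanish a i X.
Proof.
move=> HC; apply: (devissage noeth _ _ HC) => [Y|L Y Q j e]; first exact: hvanish0.
exact: hvanish_ext.
Qed.

Lemma pi_quotZ M (L : submodClosed M) (r : R) x :
  \pi_(quotmod L) (r *: x) = r *: \pi_(quotmod L) x.
Proof. by rewrite -[r *: x]addr0 pi_quot_linear pi_quot0 addr0. Qed.

Lemma fin_gen_submodule M (L : submodClosed M) :
  fin_gen [set` L] -> fin_gen [set: submodule L].
Proof.
move=> [s sE]; exists (pmap insub s : seq (submodule L)).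
apply/seteqP; split=> // x _; set s' := pmap _ _.
have sub : submod_set [set v | exists2 y : submodule L, val y = v & y \in gen_submod [set` s']].
  split=> [|r _ _ [y <- ys] [z <- zs]]; first by exists 0 => //; exact: rpred0.
  by exists (r *: y + z); rewrite ?linearP // rpredD // rpredZ.
have /set_mem[y /val_inj -> //] : val x \in submod_of sub.
have : [set` L] (val x) by exact: (valP x).
rewrite sE; apply: gen_submod_min => v vs.
have vL : v \in L by have : [set` L] v by rewrite sE; exact: mem_gen_submod.
apply/mem_set; exists (in_submodule vL) => //.
by apply: mem_gen_submod; rewrite /= mem_pmap_sub.
Qed.

Lemma AnnP M (r : R^o) : r \in Ann M <-> forall x : M, r *: x = 0.
Proof. by split=> [/set_mem|H] //; exact: mem_set. Qed.

Lemma specP q (x : R) : x \in (q : submodClosed R^o) <-> (q : set R) x.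
Proof. by split=> [/set_mem|/mem_set]. Qed.

(* Among the submodules generated by the tails of a list of generators, let K be
   the last one with Ann(M/K) in q and K + Ry the next one; if r M is in K + Ry
   and r is not in q, send x to the class of c where r x - c y is in K. *)
Lemma nonzero_map_to_prime M q :
  fin_gen [set: M] -> (forall r, r \in Ann M -> r \in (q : submodClosed R^o)) ->
  exists (g : {linear M -> quotmod q}) (x : M), g x <> 0.
Proof.
move=> [s sE] Mq.
pose P (s : seq M) := forall r : R^o,
  (forall x : M, r *: x \in gen_submod [set` s]) -> r \in (q : submodClosed R^o).
have nPs : ~ P s.
  move=> Ps; apply: (@spec_proper _ q); apply/specP; apply: Ps => x.
  rewrite scale1r; have : [set: M] x by [].
  by rewrite sE.
have [y [s' [Ps nPys]]] : exists y s', P s' /\ ~ P (y :: s').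
  elim: s nPs {sE} => [|y s IHs] nP.
    case: nP => r H; apply: Mq; apply/AnnP => x; exact: gen_submod_nil.
  by have [Ps|/IHs] := pselect (P s); first by exists y, s.
set K := gen_submod [set` s'] in Ps.
have [r rM rq] : exists2 r : R^o, (forall x : M, r *: x \in gen_submod [set` y :: s'])
    & r \notin (q : submodClosed R^o).
  apply: contrapT => H; apply: nPys => r rM; apply/negPn/negP => rq.
  by apply: H; exists r.
have Kq c : c *: y \in K -> c \in (q : submodClosed R^o).
  move=> cy; have /specP/spec_prime[/specP cq|/specP rq'] : c * r \in (q : submodClosed R^o).
  - apply: Ps => x; have /gen_submod_cons/adjoinP[d xd] := rM x.
    rewrite -scalerA -[r *: x](subrK (d *: y)) scalerDr.
    apply: rpredD; first exact: rpredZ.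
    by rewrite scalerA mulrC -scalerA rpredZ.
  - by [].
  - by rewrite rq' in rq.
have [g gE] : exists g : {linear M -> quotmod q},
    forall x, exists2 c : R^o, g x = \pi_(quotmod q) c & r *: x - c *: y \in K.
  apply: (@linear_of_rel _ M (quotmod q) (fun x v =>
    exists2 c : R^o, v = \pi_(quotmod q) c & r *: x - c *: y \in K)).
  - move=> x; have /gen_submod_cons/adjoinP[c xc] := rM x.
    by exists (\pi_(quotmod q) c), c.
  - move=> l x v x' v' [c -> xc] [c' -> x'c']; exists (l *: c + c').
      by rewrite pi_quot_linear.
    have -> : r *: (l *: x + x') - ((l *: c : R^o) + c') *: y
        = l *: (r *: x - c *: y) + (r *: x' - c' *: y).
      rewrite scale_regE scalerBr scalerDl scalerDr !scalerA [r * l]mulrC.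
      by rewrite opprD addrACA.
    by rewrite rpredD ?rpredZ.
  - move=> v [c -> ]; rewrite scaler0 sub0r => cK; apply/pi_quot_eq0/Kq.
    by rewrite -[_ *: _]opprK -scaleN1r rpredZ.
exists g, y; have [c -> yc] := gE y => /pi_quot_eq0 cq.
move/negP: rq; apply; have rcq : r - c \in (q : submodClosed R^o).
  by apply: Kq; rewrite scalerBl.
by rewrite -[r](subrK c) rpredD.
Qed.

Lemma hvanish_prime_step i M : fin_gen [set: M] -> hvanish a i M ->
  (forall q, (forall r, r \in Ann M -> r \in (q : submodClosed R^o)) ->
     hvanish a i.+1 (quotmod q)) ->
  forall q, (forall r, r \in Ann M -> r \in (q : submodClosed R^o)) ->
    hvanish a i (quotmod q).
Proof.
move=> fgM hM up q; move Eq : (ideal_of_spec q) => I.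
elim/(noetherian_ind noeth): I q Eq => I IHI q qI Mq.
subst I.
have [g [x0 gx0]] := nonzero_map_to_prime fgM Mq.
have [|h hE] := corestrict (L := lin_im g) (f := g).
  by move=> x; apply/mem_set; exists x.
have oh : onto h.
  move=> y; have /set_mem[x _ xy] := valP y; exists x.
  by apply: val_inj; rewrite hE.
(* The image is a quotient of [M] by a finitely generated kernel killed by [Ann M], so H^(i+1) of
   the kernel vanishes by [up]. *)
have hL : hvanish a i (submodule (lin_im g)).
  apply: (hvanish_quot (sexact_lin_ker oh)) => //.
  apply: (hvanish_devissage up); last first.
    by move=> r x /AnnP rM; apply: val_inj; exact: rM.
  have [s sE] := fgM; apply/fin_gen_submodule/(noetherian_sub noeth (s := s)) => x _.
  by have : [set: M] x by []; rewrite sE.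
have [e eE se] := sexact_quotmod (lin_im g).
apply: (hvanish_ext se hL).
have [c cE] := pi_quot_surj (g x0).
(* The cokernel of [g] is killed by q + Rc, because c is represented by [g x0]. As [g x0] is
   nonzero, [c] is outside [q], and every prime containing q + Rc is strictly larger than [q]. *)
apply: (hvanish_devissage (C := adjoin q c)).
- move=> q' qq'; apply: (IHI q') => //.
  + by move=> r rq; apply: qq'; exact: sub_adjoin.
  + exists c; first by apply: qq'; exact: mem_adjoin.
    by apply/negP => /pi_quot_eq0; rewrite cE.
  + by move=> r /Mq rq; apply: qq'; exact: sub_adjoin.
- exists [:: \pi_(quotmod (lin_im g)) (\pi_(quotmod q) (1 : R^o))].
  apply/seteqP; split=> // u _.
  have [v <-] := pi_quot_surj u; have [w <-] := pi_quot_surj v.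
  rewrite -[w]mulr1 -[w * 1]/(w *: (1 : R^o)) !pi_quotZ.
  by apply/rpredZ/mem_gen_submod; rewrite /= mem_head.
- move=> r u /adjoinP[d rd].
  have [v <-] := pi_quot_surj u; have [w <-] := pi_quot_surj v.
  rewrite -!pi_quotZ; apply/pi_quot_eq0/mem_set; exists ((w * d) *: x0) => //.
  rewrite linearZ /= -cE -pi_quotZ; apply/eqP; rewrite eq_quotmod.
  have -> : (w * d) *: c - r *: w = (- w) *: (r - d *: c).
    by rewrite !scale_regE; ring.
  exact: rpredZ.
Qed.

(** Descending induction on [i] from the uniform bound [c], run as an induction on [k] with c <= i +
    k. *)
Lemma hvanish_support (t : nat) M : fin_gen [set: M] ->
  (forall i, (t <= i)%N -> hvanish a i M) ->
  forall q, (forall r, r \in Ann M -> r \in (q : submodClosed R^o)) ->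
  forall i, (t <= i)%N -> hvanish a i (quotmod q).
Proof.
move=> fgM hM; have [c cP] := hvanish_bound noeth a.
suff H k : forall i q, (forall r, r \in Ann M -> r \in (q : submodClosed R^o)) ->
    (t <= i)%N -> (c <= i + k)%N -> hvanish a i (quotmod q).
  by move=> q Mq i ti; apply: (H c) => //; exact: leq_addl.
elim: k => [|k IHk] i q Mq ti ci.
  by apply: cP; rewrite addn0 in ci.
apply: (hvanish_prime_step fgM) Mq; first exact: hM.
move=> q' Mq'; apply: IHk => //; first exact: leqW.
by rewrite addSnnS.
Qed.

End Support.

(** * Prime avoidance and powers of an ideal inside another *)

Section PrimeIdeals.
Variable R : comNzRingType.
Implicit Types p q : spec R.

Lemma ideal_addr (J : submodClosed R^o) (x y : R) :
  x \in J -> y \in J -> x + y \in J.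
Proof. exact: (@rpredD R^o J). Qed.

Lemma ideal_subr (J : submodClosed R^o) (x y : R) :
  x + y \in J -> x \in J -> y \in J.
Proof.
move=> xyJ xJ; have -> : y = (x + y) + (-1) * x by ring.
by apply: ideal_addr => //; exact: ideal_mulr.
Qed.

Lemma spec_prod (I : Type) (s : seq I) (y : I -> R) q :
  (forall i, ~ (q : set R) (y i)) -> ~ (q : set R) (\prod_(i <- s) y i).
Proof.
move=> yq; elim: s => [|i s IHs]; first by rewrite big_nil; exact: spec_proper.
by rewrite big_cons => /spec_prime[/yq|/IHs].
Qed.

Lemma spec_exp q (x : R) k : (q : set R) (x ^+ k) -> (q : set R) x.
Proof.
elim: k => [|k IHk]; first by move=> /(@spec_proper _ q).
by rewrite exprS => /spec_prime[].
Qed.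

Lemma ideal_prod (I : eqType) (s : seq I) (y : I -> R) (J : submodClosed R^o) i :
  i \in s -> y i \in J -> \prod_(j <- s) y j \in J.
Proof.
elim: s => // j s IHs; rewrite inE big_cons => /predU1P[->|js] yJ.
  by rewrite mulrC; exact: ideal_mulr.
exact/ideal_mulr/IHs.
Qed.

(* With z in I avoiding the primes of s, pick y in I outside q and in every prime
   of s not contained in q: one of z, z + y avoids q and the primes of s. *)
Lemma prime_avoidance (I : eqType) (s : seq I) (p_ : I -> spec R)
    (J : submodClosed R^o) :
  (forall i, i \in s -> exists2 x, x \in J & ~ (p_ i : set R) x) ->
  exists2 z, z \in J & forall i, i \in s -> ~ (p_ i : set R) z.
Proof.
elim: s => [|i0 s IHs] H; first by exists 0; rewrite ?rpred0.
have [|z zJ zs] := IHs; first by move=> i si; apply: H; rewrite inE si orbT.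
have [zq|zq] := pselect ((p_ i0 : set R) z); last first.
  by exists z => // i; rewrite inE => /predU1P[->|/zs].
have [w wJ wq] := H i0 (mem_head _ _).
have /choice[y yP] : forall i, exists y : R, ~ (p_ i0 : set R) y /\
    ((p_ i : set R) `<=` p_ i0 \/ (p_ i : set R) y).
  move=> i; have [sub|] := pselect ((p_ i : set R) `<=` p_ i0).
    by exists 1; split; [exact: spec_proper | left].
  by move=> /existsNP[v /not_implyP[vi vq]]; exists v; split; [|right].
pose v := w * \prod_(i <- s) y i.
have vJ : v \in J by rewrite /v mulrC; exact: ideal_mulr.
have vq : ~ (p_ i0 : set R) v.
  by move=> /spec_prime[//|]; apply: spec_prod => i; have [] := yP i.
have zvq : ~ (p_ i0 : set R) (z + v).
  move=> /specP zvq; apply/vq/specP; move/specP in zq.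
  exact: ideal_subr zvq zq.
exists (z + v); first exact: ideal_addr.
move=> i; rewrite inE => /predU1P[->//|si]; have [_ [sub /sub//|yi]] := yP i.
move=> /specP zvi; apply: (zs i si); apply/specP.
have vi : v \in (p_ i : submodClosed R^o).
  by apply/ideal_mulr/(ideal_prod si)/specP.
by rewrite addrC in zvi; exact: ideal_subr zvi vi.
Qed.

(** Induction on generators: if I'^k and x^l lie in [J], then so does (I' + Rx)^(k + l), by
    [ideal_pow_adjoin_sub]. *)
Lemma ideal_pow_radical (noeth : noetherian R) (I J : submodClosed R^o) :
  (forall r : R, r \in I -> exists k, r ^+ k \in J) ->
  exists k, forall z, z \in ideal_pow I k -> z \in J.
Proof.
have [s sE] := noeth I; have -> : I = gen_submod [set` s] by exact: submod_inj.
move=> H; have {sE} : forall r : R, r \in s -> exists k, r ^+ k \in J.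
  by move=> r rs; apply/H/mem_gen_submod.
elim: s {H} => [|x s IHs] H.
  exists 1%N => z; apply: gen_submod_min => _ [r /gen_submod_nil -> [w _ <-]].
  by rewrite mul0r; exact: (rpred0 J).
have [|k kP] := IHs; first by move=> r rs; apply: H; rewrite inE rs orbT.
have [l lP] := H x (mem_head _ _).
exists (k + l)%N => z zI.
have /adjoinP[c zc] : z \in adjoin (ideal_pow (gen_submod [set` s]) k) (x ^+ l : R^o).
  by apply: ideal_pow_adjoin_sub; apply: ideal_pow_mono zI => y /gen_submod_cons.
rewrite -[z](subrK (c *: (x ^+ l : R^o))); apply: ideal_addr; first exact: kP.
exact: ideal_mulr.
Qed.

End PrimeIdeals.

(** * Primary decomposition of the zero submodule *)

Section PrimaryDecomposition.
Variables (R : comNzRingType) (noeth : noetherian R) (N : lmodType R).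
Variables (n : nat) (N_ : 'I_n -> submodClosed N) (p_ : 'I_n -> spec R).
Hypothesis decN : min_primary_decomposition N_ p_.

(** [p_ i] is the annihilator of a class of N/N_i, nonzero because [p_ i] is proper. An element
    killing it is a zero divisor on N/N_i, hence nilpotent there by primarity. *)
Lemma primary_exp i r : (p_ i : set R) r -> exists k, forall y, r ^+ k *: y \in N_ i.
Proof.
have : Ass (quotmod (N_ i)) (p_ i) by rewrite (mpd_ass decN).
case=> u pE; have [x xu] := pi_quot_surj u; subst u.
rewrite pE /= -pi_quotZ => /pi_quot_eq0 rx.
have [_ /(_ r x rx)[xN|//]] := mpd_primary decN i.
case: (@spec_proper _ (p_ i)); rewrite pE /= scale1r; exact/pi_quot_eq0.
Qed.

(** A power of [r] that kills N/N_i kills the class whose annihilator is [p_ i], which would put [r]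
    into [p_ i]. *)
Lemma primary_cancel i r x :
  ~ (p_ i : set R) r -> r *: x \in N_ i -> x \in N_ i.
Proof.
move=> ri rx; have [_ /(_ r x rx)[//|[k kP]]] := mpd_primary decN i.
have : Ass (quotmod (N_ i)) (p_ i) by rewrite (mpd_ass decN).
case=> u pE; have [y yu] := pi_quot_surj u; subst u.
case: ri; apply: (@spec_exp _ _ _ k); rewrite pE /= -pi_quotZ.
exact/pi_quot_eq0/kP.
Qed.

Lemma primary_pow (I : submodClosed R^o) i :
  (forall r, r \in I -> (p_ i : set R) r) ->
  exists k, forall z, z \in ideal_pow I k -> forall y, z *: y \in N_ i.
Proof.
move=> Ip; have sub : @submod_set R R^o [set r : R | forall y, r *: y \in N_ i].
  split=> [y|r u v uN vN y]; first by rewrite scale0r rpred0.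
  by rewrite scalerDl rpredD // scale_regE -scalerA rpredZ.
have [r /Ip/primary_exp[k kP]|k kP] := @ideal_pow_radical R noeth I (submod_of sub).
  by exists k; apply/mem_set.
by exists k => z /kP/set_mem.
Qed.

Lemma decomposition0 x : (forall i, x \in N_ i) -> x = 0.
Proof.
move=> xN; suff : (\bigcap_(i in [set: 'I_n]) [set` N_ i]) x by rewrite (mpd_zero decN).
by move=> i _; exact: xN.
Qed.

(** If p = Ann x were none of the [p_ i], each [N_ i] would contain some y_i x with y_i outside [p],
    and the product of the y_i would kill [x]. Conversely, irredundancy gives a nonzero [x] in all
    [N_ j] with j <> i; a nonzero multiple z x, with z in the last power of [p_ i] not killing [x],
    has annihilator [p_ i]. *)
Lemma Ass_decomposition p : Ass N p <-> exists i, p = p_ i.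
Proof.
split=> [[x pE]|[i ->]].
  have pP r : (p : set R) r <-> r *: x = 0 by rewrite pE.
  apply: contrapT => np.
  have sub i : x \notin N_ i -> (p : set R) `<=` p_ i.
    move=> /negP xi r /pP rx; apply: contrapT => ri; apply/xi/(primary_cancel ri).
    by rewrite rx rpred0.
  have /choice[y yP] : forall i, exists y : R, ~ (p : set R) y /\ y *: x \in N_ i.
    move=> i; have [xi|xi] := boolP (x \in N_ i).
      by exists 1; rewrite scale1r; split=> //; exact: spec_proper.
    (* As [p] is contained in [p_ i] and differs from it, some [r] in [p_ i] is outside [p]; a power
       of it sends [x] into [N_ i]. *)
    have /existsNP[r /not_implyP[ri rp]] : ~ ((p_ i : set R) `<=` p).
      move=> sub'; apply: np; exists i; apply: spec_inj; apply/seteqP; split=> //.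
      exact: sub.
    have [k kP] := primary_exp ri; exists (r ^+ k); split; last exact: kP.
    by move=> /spec_exp.
  apply: (@spec_prod _ _ (enum 'I_n) y p) => [i|]; first by have [] := yP i.
  apply/pP/decomposition0 => i.
  have := @ideal_prod _ _ (enum 'I_n) y (colon (N_ i) x) i.
  rewrite !colonE; apply; first by rewrite mem_enum.
  by have [] := yP i.
have [x [xN x0]] : exists x, (forall j, j <> i -> x \in N_ j) /\ x <> 0.
  apply: contrapT => H; apply: (mpd_irredundant decN (j := i)); apply/seteqP; split=> x.
    move=> xN; apply: contrapT => x0; apply: H.
    exists x; split; last exact: x0.
    by move=> j ji; exact: (xN j ji).
  by move=> -> j _; exact: rpred0.
have [|k kP] := @primary_pow (p_ i) i; first by move=> r /specP.
have xk : forall z, z \in ideal_pow (p_ i) k -> z *: x = 0.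
  move=> z /kP zN; apply: decomposition0 => j; have [->|/eqP ji] := eqVneq j i.
    exact: zN.
  by apply/rpredZ/xN.
elim: k xk {kP} => [|k IHk] xk; first by case: x0; rewrite -[x]scale1r xk // ideal_pow0.
have [/IHk//|/existsNP[z /not_implyP[zk zx]]] :=
  pselect (forall z, z \in ideal_pow (p_ i) k -> z *: x = 0).
exists (z *: x); apply/seteqP; split=> r /= rz.
  by rewrite scalerA; apply/xk/mem_ideal_mul => //; exact/specP.
apply: contrapT => ri; apply: zx; apply: decomposition0 => j.
have [->|/eqP ji] := eqVneq j i; last by apply/rpredZ/xN.
by apply: (primary_cancel ri); rewrite rz rpred0.
Qed.

(** * Components at a set of associated primes closed under smaller ones *)

Variables (D : set (spec R)) (I : submodClosed R^o).
Hypothesis DAss : D `<=` Ass N.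
Hypothesis Ddown : forall p q, Ass N p -> D q -> (p : set R) `<=` q -> D p.
Hypothesis IP : forall z, z \in I <-> forall p, Ass N p -> ~ D p -> (p : set R) z.

(** Otherwise a product of elements y_i outside [q], with y_i in [p_ i] whenever [p_ i] is not in
    [D], would lie in [I] but not in [q]. *)
Lemma prime_over_complement (q : spec R) : (forall z, z \in I -> (q : set R) z) ->
  exists i, ~ D (p_ i) /\ (p_ i : set R) `<=` q.
Proof.
move=> Iq; apply: contrapT => H.
have /choice[y yP] : forall i, exists y : R, ~ (q : set R) y /\ (D (p_ i) \/ (p_ i : set R) y).
  move=> i; have [Di|Di] := pselect (D (p_ i)).
    by exists 1; split; [exact: spec_proper | left].
  have /existsNP[v /not_implyP[vi vq]] : ~ ((p_ i : set R) `<=` q).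
    by move=> iq; apply: H; exists i.
  by exists v; split; [|right].
apply: (@spec_prod _ _ (enum 'I_n) y q) => [i|]; first by have [] := yP i.
apply/Iq/IP => p /Ass_decomposition[i ->] Di.
apply/specP/(@ideal_prod _ _ _ _ _ i); first by rewrite mem_enum.
by apply/specP; have [_ []] := yP i.
Qed.

Lemma mem_contract (S : mulrClosed R) (L : submodClosed N) x :
  x \in loc_contract S L <-> exists2 s, s \in S & s *: x \in L.
Proof. by rewrite -loc_contractE; split=> [/set_mem|H] //; exact: mem_set. Qed.

Lemma mem_zero_submod (x : N) : x \in zero_submod N <-> x = 0.
Proof. by split=> [/set_mem|H] //; exact: mem_set. Qed.

(** One exponent [k] takes I^k N into every [N_ i] with [p_ i] outside [D]; the other components
    already contain [x], so I^k x lies in all of them. *)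
Lemma sub_bigcap_Gamma :
  \bigcap_(i in [set i | D (p_ i)]) [set` N_ i] `<=` Gamma I N.
Proof.
move=> x xN.
have [k kP] : exists k, forall i, i \in enum 'I_n -> ~ D (p_ i) ->
    forall z, z \in ideal_pow I k -> forall y, z *: y \in N_ i.
  apply: (@uniform_bound _ (fun i k => ~ D (p_ i) ->
    forall z, z \in ideal_pow I k -> forall y, z *: y \in N_ i)).
    by move=> i k l kl H Di z /(ideal_pow_sub kl) zk; exact: H.
  move=> i _; have [Di|Di] := pselect (D (p_ i)); first by exists 0%N.
  have [|k kP] := @primary_pow I i; last by exists k => _.
  by move=> r /IP rI; apply: rI => //; apply/Ass_decomposition; exists i.
exists k => // r rk; apply: decomposition0 => i.
have [Di|Di] := pselect (D (p_ i)); first by apply/rpredZ/xN.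
by apply: kP => //; rewrite mem_enum.
Qed.

(** No prime of [D] contains [I]: it would contain an associated prime outside [D], against [Ddown].
    Prime avoidance gives [z] in [I] outside all primes of [D], and z^k kills [x]. *)
Lemma sub_Gamma_contract :
  Gamma I N `<=` [set` loc_contract (compl_union D) (zero_submod N)].
Proof.
move=> x [k _ xk]; have [z zI zD] : exists2 z, z \in I &
    forall i, i \in [seq i <- enum 'I_n | `[< D (p_ i) >]] -> ~ (p_ i : set R) z.
  apply: prime_avoidance => i; rewrite mem_filter => /andP[/asboolP Di _].
  apply: contrapT => H; have [|j [Dj ji]] := @prime_over_complement (p_ i).
    by move=> z zI; apply: contrapT => zi; apply: H; exists z.
  by apply/Dj/(Ddown _ Di ji)/Ass_decomposition; exists j.
apply/mem_contract; exists (z ^+ k).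
  apply/mem_set => -[p Dp /spec_exp pz]; have /Ass_decomposition[i pi] := DAss Dp.
  apply: (zD i); last by rewrite -pi.
  by rewrite mem_filter mem_enum andbT; apply/asboolP; rewrite -pi.
by apply/mem_zero_submod/xk/mem_ideal_exp.
Qed.

Lemma sub_contract_bigcap :
  [set` loc_contract (compl_union D) (zero_submod N)] `<=`
  \bigcap_(p in D) [set` contract_at p (zero_submod N)].
Proof.
move=> x /mem_contract[s /set_mem sS sx] p Dp; apply/mem_contract; exists s => //.
by apply/mem_set => ps; apply: sS; exists p.
Qed.

Lemma sub_bigcap_decomposition :
  \bigcap_(p in D) [set` contract_at p (zero_submod N)] `<=`
  \bigcap_(i in [set i | D (p_ i)]) [set` N_ i].
Proof.
move=> x xD i Di; have /mem_contract[s /set_mem sp /mem_zero_submod sx] := xD _ Di.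
by apply: (primary_cancel sp); rewrite sx rpred0.
Qed.

End PrimaryDecomposition.

(** * Cohomological dimension at primes, and annihilators *)

Section Annihilators.
Variable R : comNzRingType.
Implicit Types M N : lmodType R.

Lemma cohom_dim_lt_nat (a : submodClosed R^o) (t : int) :
  exists t' : nat, forall M,
    (cohom_dim a M < t%:E)%E <-> forall i, (t' <= i)%N -> hvanish a i M.
Proof.
(* For negative [t] every degree counts, so the threshold is 0. *)
case: t => t; [exists t | exists 0%N] => M; apply: (iff_trans (cohom_dim_lt _ _ _)).
  by split=> H i ti; apply: H; rewrite ?lez_nat // -lez_nat.
by split=> H i _; apply: H.
Qed.

Lemma cohom_dim_lt_support (noeth : noetherian R) (a : submodClosed R^o) (t : int)
    M (q : spec R) : fin_gen [set: M] -> (cohom_dim a M < t%:E)%E ->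
  (forall r, r \in Ann M -> r \in (q : submodClosed R^o)) ->
  (cohom_dim a (quotmod q) < t%:E)%E.
Proof.
have [t' tP] := cohom_dim_lt_nat a t => fgM /tP hM Mq; apply/tP.
exact: (hvanish_support noeth fgM hM).
Qed.

Lemma fin_gen_quot_regular (I : submodClosed R^o) : fin_gen [set: quotmod I].
Proof.
exists [:: \pi_(quotmod I) (1 : R^o)]; apply/seteqP; split=> // u _.
have [w <-] := pi_quot_surj u.
rewrite -[w]mulr1 -[w * 1]/(w *: (1 : R^o)) pi_quotZ.
by apply/rpredZ/mem_gen_submod; rewrite /= mem_head.
Qed.

Lemma Ann_quotmodP M (L : submodClosed M) (r : R^o) :
  r \in Ann (quotmod L) <-> forall x, r *: x \in L.
Proof.
split=> [/AnnP rL x|rL]; first by apply/pi_quot_eq0; rewrite pi_quotZ rL.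
apply/AnnP => q; have [x <-] := pi_quot_surj q.
by apply: etrans (esym (pi_quotZ L r x)) _; exact/pi_quot_eq0.
Qed.

(** For [r] on the left, each generator x of [N] has its own multiplier outside [p] killing r x; the
    product of these finitely many multipliers kills r N and is still outside [p]. *)
Lemma Ann_quot_contract N (D : set (spec R)) : fin_gen [set: N] ->
  [set` Ann (quotmod (bigcap_submod D (fun p => contract_at p (zero_submod N))))]
  = \bigcap_(p in D) [set` contract_at p (Ann N)].
Proof.
move=> [s sE]; apply/seteqP; split=> [r rA p Dp|r rA].
  have {}rA : forall x : N, exists2 u : R, u \in ~` (p : set R) & u *: (r *: x) = 0.
    move=> x; have /Ann_quotmodP/(_ x)/set_mem/(_ p Dp) :
      r \in Ann (quotmod (bigcap_submod D (fun p => contract_at p (zero_submod N)))) by exact: rA.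
    by move=> /mem_contract[u up /mem_zero_submod ur]; exists u.
  have [u up uP] : exists2 u : R, ~ (p : set R) u & forall x, x \in s -> u *: (r *: x) = 0.
    elim: (s) => [|y s' [u up uP]]; first by exists 1 => //; exact: spec_proper.
    have [v /set_mem vp vy] := rA y; exists (u * v); first by move=> /spec_prime[].
    move=> x; rewrite inE => /predU1P[->|xs]; first by rewrite -scalerA vy scaler0.
    by rewrite mulrC -scalerA uP ?scaler0.
  apply/mem_contract; exists u; first exact: mem_set.
  apply/AnnP => x; have : [set: N] x by []; rewrite sE => xs.
  have sub : submod_set [set x : N | u *: (r *: x) = 0].
    split=> [|l y z y0 z0] /=; first by rewrite !scaler0.
    have E : u *: (r *: (l *: y)) = l *: (u *: (r *: y)).
      by rewrite !scalerA [u * r * l]mulrC mulrA.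
    by rewrite !scalerDr z0 addr0 E y0 scaler0.
  rewrite -[(u *: r) *: x]scalerA.
  suff /set_mem : x \in submod_of sub by [].
  by apply: gen_submod_min xs => y ys; apply/mem_set/uP.
suff : r \in Ann (quotmod (bigcap_submod D (fun p => contract_at p (zero_submod N)))) by [].
apply/Ann_quotmodP => x; apply/mem_set => p Dp.
have /mem_contract[u up /AnnP ur] := rA p Dp.
apply/mem_contract; exists u => //; apply/mem_zero_submod.
by rewrite scalerA; exact: ur.
Qed.

(** Multiplication by [r] factors through [K], so r times a cocycle is a cocycle with values in [K],
    which becomes a coboundary there. *)
Lemma scaled_class_eq0 (a : submodClosed R^o) i N (K : submodClosed N) (r : R) :
  (forall x, r *: x \in K) -> hvanish a i (submodule K) ->
  forall x : local_cohomology a (Posz i) N, r *: x = 0.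
Proof.
move=> rK hK x; have [m [z <-]] := local_class_surj x.
pose din := @dirlim_in R (fun n => ext (quotmod (ideal_pow a n)) N i)
  (fun n => ext_map N (quot_pow_proj a n) i) m.
have dinZ y : r *: din y = din (r *: y).
  have lin := @dirlim_in_linear R _ (fun n => ext_map N (quot_pow_proj a n) i) m.
  have d0 : din 0 = 0.
    have := lin (-1) 0 0; rewrite scaler0 addr0 -/din => d0.
    by rewrite -/(din 0) [LHS]d0 scaleN1r addNr.
  by have := lin r y 0; rewrite addr0 -/din -/(din 0) d0 addr0.
apply: etrans (dinZ _) _; rewrite -pi_quotZ; apply/local_class_eq0.
pose f := hom_fun (val z).
have [|g gE] := corestrict (f := r \*: f) (L := K); first by move=> w; exact: rK.
have [|k [mk cb]] := hK m g.
  move=> w; apply: val_inj; rewrite gE.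
  have fw : f (resolution_d _ i w) = 0 := cocyclesP z w.
  exact: etrans (congr1 ( *:%R r) fw) (scaler0 _ _).
exists k, mk; apply: coboundary_ext (coboundary_post \val cb) => w /=.
by rewrite [LHS]gE.
Qed.

Lemma Ann_local_cohomology (a : submodClosed R^o) (t : int) N
    (K : submodClosed N) (r : R) :
  (forall x, r *: x \in K) -> (cohom_dim a (submodule K) < t%:E)%E ->
  r \in Ann (local_cohomology a t N).
Proof.
move=> rK /cohom_dim_lt; case: t => i hK; apply/AnnP => x.
  exact/(scaled_class_eq0 rK)/hK.
(* In negative degrees local cohomology is the zero module ['rV[R]_0]. *)
by apply/rowP => -[].
Qed.

End Annihilators.

(** * The three statements for [Delta a N t] and [ideal_at a N t] *)

Import Order.TTheory.

Theorem theorem3p2 (R : comNzRingType) (N : lmodType R) (a : submodClosed R^o)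
    (n : nat) (N_ : 'I_n -> submodClosed N) (p_ : 'I_n -> spec R) (t : int)
    (noethR : noetherian R) (fgN : fin_gen [set: N])
    (nzN : exists x : N, x != 0)
    (decN : min_primary_decomposition N_ p_) :
  let D := Delta a N t in
  let S := compl_union D in
  [/\ (* (i) *)
      [/\ \bigcap_(i in [set i | D (p_ i)]) [set` N_ i]
            = \bigcap_(p in D) [set` contract_at p (zero_submod N)],
          \bigcap_(p in D) [set` contract_at p (zero_submod N)]
            = [set` loc_contract S (zero_submod N)],
          [set` loc_contract S (zero_submod N)] = Gamma (ideal_at a N t) N
        & forall (m : nat) (N'_ : 'I_m -> submodClosed N) (p'_ : 'I_m -> spec R),
            min_primary_decomposition N'_ p'_ ->
            \bigcap_(i in [set i | D (p'_ i)]) [set` N'_ i]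
              = \bigcap_(i in [set i | D (p_ i)]) [set` N_ i]],
      (* (ii) *)
      forall L : submodClosed N,
        (cohom_dim a (submodule L) < t%:E)%E
        <-> [set` L] `<=` [set` loc_contract S (zero_submod N)]
    & (* (iii) *)
      [set` Ann (quotmod (bigcap_submod D
                            (fun p => contract_at p (zero_submod N))))]
        = \bigcap_(p in D) [set` contract_at p (Ann N)]
      /\ \bigcap_(p in D) [set` contract_at p (Ann N)] `<=` [set` Ann (local_cohomology a t N)] ].
Proof.
move=> D S; set I := ideal_at a N t.
have DAss : D `<=` Ass N by move=> p [].
have AnnQ (p : spec R) r : r \in Ann (quotmod p) -> r \in (p : submodClosed R^o).
  by move=> /Ann_quotmodP/(_ 1); rewrite -[r *: _]/(r * 1) mulr1.
(* If R/p had dimension below [t], so would R/q, since [q] contains the annihilator of R/p. *)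
have Ddown p q : Ass N p -> D q -> (p : set R) `<=` q -> D p.
  move=> pN [qN tq] pq; split=> //; rewrite leNgt; apply/negP => cp.
  move: tq; rewrite leNgt => /negP; apply.
  apply: (cohom_dim_lt_support noethR (fin_gen_quot_regular p) cp) => r /AnnQ /specP rp.
  exact/specP/pq.
have IP z : z \in I <-> forall p, Ass N p -> ~ D p -> (p : set R) z.
  split=> [/set_mem zI p pN Dp|H].
    apply/specP/(zI p); split=> //; rewrite ltNge; apply/negP => tp.
    exact: Dp.
  apply/mem_set => p [pN cp]; apply/specP/H => // -[_].
  by rewrite leNgt cp.
(* The cycle is stated for every decomposition; its other terms do not mention the decomposition,
   which gives the independence claim. *)
have DI m (N'_ : 'I_m -> submodClosed N) (p'_ : 'I_m -> spec R) :
    min_primary_decomposition N'_ p'_ ->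
    [/\ \bigcap_(i in [set i | D (p'_ i)]) [set` N'_ i] `<=` Gamma I N,
        Gamma I N `<=` [set` loc_contract S (zero_submod N)],
        [set` loc_contract S (zero_submod N)] `<=`
          \bigcap_(p in D) [set` contract_at p (zero_submod N)] &
        \bigcap_(p in D) [set` contract_at p (zero_submod N)] `<=`
          \bigcap_(i in [set i | D (p'_ i)]) [set` N'_ i]].
  move=> dec; split.
  - exact: (sub_bigcap_Gamma noethR dec IP).
  - exact: (sub_Gamma_contract noethR dec DAss Ddown IP).
  - exact: sub_contract_bigcap.
  - exact: sub_bigcap_decomposition dec _.
have eqD m (N'_ : 'I_m -> submodClosed N) (p'_ : 'I_m -> spec R) :
    min_primary_decomposition N'_ p'_ ->
    \bigcap_(i in [set i | D (p'_ i)]) [set` N'_ i]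
      = \bigcap_(p in D) [set` contract_at p (zero_submod N)].
  by move=> /DI[s1 s2 s3 s4]; apply/seteqP; split=> // x /s1/s2/s3.
have [s1 s2 s3 s4] := DI _ _ _ decN.
have eqS : \bigcap_(p in D) [set` contract_at p (zero_submod N)]
    = [set` loc_contract S (zero_submod N)].
  by apply/seteqP; split=> // x /s4/s1/s2.
have eqG : [set` loc_contract S (zero_submod N)] = Gamma I N.
  by apply/seteqP; split=> // x /s3/s4/s1.
have fgL (L : submodClosed N) : fin_gen [set: submodule L].
  have [s sE] := fgN; apply/fin_gen_submodule/(noetherian_sub noethR (s := s)) => x _.
  by have : [set: N] x by []; rewrite sE.
have ii (L : submodClosed N) : (cohom_dim a (submodule L) < t%:E)%E
    <-> [set` L] `<=` [set` loc_contract S (zero_submod N)].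
  split=> [cL x xL|].
    (* If no element outside [p] killed [x], then the annihilator of [L] would lie in [p], forcing
       the dimension of R/p below [t]. *)
    rewrite -eqS => p Dp; apply/mem_contract; apply: contrapT => H.
    have [_] := Dp; rewrite leNgt => /negP; apply.
    apply: (cohom_dim_lt_support noethR (fgL L) cL) => r /AnnP rL.
    apply/specP; apply: contrapT => rp; apply: H; exists r; first exact: mem_set.
    apply/mem_zero_submod; have xL' : x \in L by exact: xL.
    exact: (congr1 val (rL (in_submodule xL'))).
  (* Finite generation of [L] gives one [k] with I^k L = 0. A prime containing I^k contains [I],
     hence some [p_ j] outside [D], so devissage applies. *)
  rewrite eqG => LG; have [t' tP] := cohom_dim_lt_nat a t; apply/tP => i ti.
  have [s sE] : fin_gen [set` L].
    have [s sE] := fgN; apply: (noetherian_sub noethR (s := s)) => x _.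
    by have : [set: N] x by []; rewrite sE.
  have [k kP] : exists k, forall x, x \in s -> forall r, r \in ideal_pow I k -> r *: x = 0.
    apply: uniform_bound => [x k l kl H r /(ideal_pow_sub kl)|x xs]; first exact: H.
    have /LG[k _ kP] : [set` L] x by rewrite sE; exact: mem_gen_submod.
    by exists k.
  have kL r x : r \in ideal_pow I k -> x \in L -> r *: x = 0.
    move=> rk xL; have : [set` L] x by [].
    rewrite sE => xs; have sub : submod_set [set x : N | r *: x = 0].
      split=> [|l y z y0 z0] /=; first by rewrite scaler0.
      by rewrite scalerDr z0 addr0 scalerA mulrC -scalerA y0 scaler0.
    suff /set_mem : x \in submod_of sub by [].
    by apply: gen_submod_min xs => y ys; apply/mem_set/kP.
  apply: (hvanish_devissage noethR (C := ideal_pow I k)) (fgL L) _ => [q Iq|r x rk]; last first.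
    by apply: val_inj; apply: kL => //; exact: (valP x).
  have [|j [Dj jq]] := prime_over_complement noethR decN IP (q := q).
    by move=> z zI; apply: (@spec_exp _ _ _ k); apply/specP/Iq/mem_ideal_exp.
  have cj : (cohom_dim a (quotmod (p_ j)) < t%:E)%E.
    rewrite ltNge; apply/negP => tj; apply: Dj; split=> //.
    by apply/(Ass_decomposition noethR decN); exists j.
  move: i ti; apply/tP.
  apply: (cohom_dim_lt_support noethR (fin_gen_quot_regular _) cj) => r /AnnQ /specP rp.
  exact/specP/jq.
split.
- split=> //; first exact: eqD.
  by move=> m N'_ p'_ dec; rewrite (eqD _ _ _ dec) (eqD _ _ _ decN).
- exact: ii.
split; first exact: Ann_quot_contract.
rewrite -Ann_quot_contract // => r rA.
have rK x : r *: x \in loc_contract S (zero_submod N).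
  have /Ann_quotmodP/(_ x)/set_mem rx :
    r \in Ann (quotmod (bigcap_submod D (fun p => contract_at p (zero_submod N)))) by exact: rA.
  by have : [set` loc_contract S (zero_submod N)] (r *: x) by rewrite -eqS.
suff : r \in Ann (local_cohomology a t N) by [].
apply: (@Ann_local_cohomology _ a t N (loc_contract S (zero_submod N)) r rK).
(* The contraction is contained in itself, so (ii) puts its cohomological dimension below [t]. *)
exact: (ii (loc_contract S (zero_submod N))).2 (fun x xK => xK).
Qed.
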